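(* Let $\sigma=\mathcal{O}(E)$ be a stratum of an orthant space $X^m$, let $x^*\in\sigma$ and let $x\in X^m$ be any point. Suppose that $\sigma$ bounds $\tau=\mathcal{O}(E\cup F)$ in $X^m$ and that $w_\tau\in\mathbb{R}(E)\times\mathcal{O}(F)$ is tangent to $\tau$ at $x^*$. Then (i) $\displaystyle\lim_{\lambda\to0+}\Phi_\tau(x;x^*(\lambda,w_\tau))=\lim_{\lambda\to0+}\Phi_\tau(x;x^*(\lambda,w_\tau^\perp))=\Psi_\tau(x,w_\tau;x^* )$; (ii) $P_\sigma\left(\Psi_\tau(x,w_\tau;x^* )\right)=\Phi_\sigma(x;x^* )$.
   Context: Orthant spaces. Let $U=(u_1,\dots,u_M)$ be the standard orthonormal basis of $\mathbb{R}^M$. For $E\subseteq U$, $\mathbb{R}(E)$ is the span of $E$ and $\mathcal{O}(E)=\{\sum_{e\in E}\lambda_e e:\lambda_e>0\}$ is an open positive orthant ($\mathcal{O}(\emptyset)=\{o\}$, $o$ the origin). An orthant space $X^m$ of dimension $m\le M$ is a subspace of $\mathbb{R}^M$ that is a union of open positive orthants (its strata) of maximum dimension $m$, with the intrinsic (length) metric $d$ induced from the Euclidean metric, such that (a) for every orthant $\sigma$ in $X^m$ the orthants in its closure are also in $X^m$; (b) if all the 2-dimensional orthants in the closure of a positive orthant $\sigma$ of $\mathbb{R}^M$ are in $X^m$ then $\sigma$ is in $X^m$. $X^m$ is a CAT(0)-space, so any two points are joined by a unique geodesic. $\mathcal{O}(E)$ bounds $\mathcal{O}(G)$ if $E\subseteq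 G$; in $E\cup F$ the sets $E$, $F$ are disjoint, and $F\neq\emptyset$. Logarithm map. For $x^*\in\sigma=\mathcal{O}(E)$ the tangent cone to $X^m$ at $x^*$ is the union of $\mathbb{R}(E)\times\overline{\mathcal{O}(F)}$ over $F$ disjoint from $E$ with $\mathcal{O}(E\cup F)\subseteq X^m$, glued along common faces and regarded in $\mathbb{R}^M$; translated to the origin it is $C_\sigma$. Vectors in $\mathbb{R}(E)\times\mathcal{O}(F)$ are said to be tangent to $\tau=\mathcal{O}(E\cup F)$ at $x^*$. $\log_{x^*}(x)$ is the initial (one-sided) tangent vector, of norm $d(x^*,x)$, of the geodesic from $x^*$ to $x$; $\Phi(x;x^* )=\log_{x^*}(x)+x^*\in C_\sigma$. For $w$ in the tangent cone at $x^*$, $x^*(\lambda,w)$ is the point at distance $\lambda\|w\|$ along the geodesic starting at $x^*$ with initial tangent vector $w$ (equal to $x^*+\lambda w$ for small $\lambda>0$). $w_\tau^\perp$ is the component of $w_\tau$ in $\{\mathbf 0\}\times\mathcal{O}(F)$. Projections and limits. For a stratum $\sigma=\mathcal{O}(E)$, $P_\sigma$ is the orthogonal projection onto $\mathbb{R}(E)$ (similarly $P_\tau$, onto $\mathbb{R}(E\cup F)$). $\Phi_\sigma(x;x')=P_\sigma(\Phi(x;x'))$, $\Phi_\tau(x;x')=P_\tau(\Phi(x;x'))$. $\Psi(x,w_\tau;x^* )=\lim_{\lambda\to0+}\Phi(x;x^*(\lambda,w_\tau))\in C_\tau$ (this limit exists) and $\Psi_\tau(x,w_\tau;x^* )=P_\tau(\Psi(x,w_\tau;x^*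 ))$. *)

(* Defs.v *)
(* A point of R^M is a row vector
   'rV[R]_M; the standard basis is indexed by 'I_M, and a set of basis vectors
   is an element of {set 'I_M}. *)
From HB Require Import structures.
From mathcomp Require Import all_boot all_order all_algebra.
From mathcomp Require Import all_classical all_reals all_analysis.

Set Implicit Arguments.
Unset Strict Implicit.
Unset Printing Implicit Defensive.

Import Order.TTheory GRing.Theory Num.Theory.
Import numFieldNormedType.Exports.

Local Open Scope classical_set_scope.
Local Open Scope ring_scope.

Section OrthantSpaces.
Context {R : realType} {M : nat}.
Implicit Types (E F G : {set 'I_M}) (X : set 'rV[R]_M) (x y v w : 'rV[R]_M).

(* The library's norm on 'rV[R]_M is the sup norm.  It induces the Euclidean
   topology, so limits and continuity below are the library's, while lengths
   and distances use [enorm]. *)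
Definition enorm v : R := Num.sqrt (\sum_i v 0 i ^+ 2).

Definition orthant E : set 'rV[R]_M :=
  [set v | forall i, (i \in E -> 0 < v 0 i) /\ (i \notin E -> v 0 i = 0)].

(* Condition (b) is vacuous for orthants of dimension at most 1, so the origin
   and all the coordinate half-axes belong to an orthant space. *)
Definition orthant_space (m : nat) X : Prop :=
  [/\ exists S : set {set 'I_M}, X = \bigcup_(E in S) orthant E,
      (exists2 E, orthant E `<=` X & #|E| = m) /\
        (forall E, orthant E `<=` X -> (#|E| <= m)%N),
      forall E G, orthant G `<=` X -> orthant E `<=` closure (orthant G) ->
        orthant E `<=` X &
      forall G,
        (forall E, #|E| = 2%N -> orthant E `<=` closure (orthant G) ->
          orthant E `<=` X) ->
        orthant G `<=` X].

(* Sum of the Euclidean lengths of the chords over a subdivision of [0, 1];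
   the analogue of the library's [variation] for vector-valued functions. *)
Definition polygonal_length (g : R -> 'rV[R]_M) (s : seq R) : R :=
  let G := g \o nth 1 (0 :: s) in
  \sum_(0 <= n < size s) enorm (G n.+1 - G n).

Definition path_length (g : R -> 'rV[R]_M) : \bar R :=
  ereal_sup [set (polygonal_length g s)%:E | s in itv_partition 0 1].

Definition path_in X x y : set (R -> 'rV[R]_M) :=
  [set g : R -> 'rV[R]_M |
    [/\ {within `[0 : R, 1 : R], continuous g},
        forall t : R, 0 <= t <= 1 -> X (g t), g 0 = x & g 1 = y]].

Definition intrinsic_dist X x y : R :=
  fine (ereal_inf [set path_length g | g in path_in X x y]).

(* [g] restricted to [0, l] is a (minimal) geodesic of [X] of constant
   speed [c]. *)
Definition geodesic X (c l : R) (g : R -> 'rV[R]_M) : Prop :=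
  (forall t, 0 <= t <= l -> X (g t)) /\
  (forall s t, 0 <= s <= l -> 0 <= t <= l ->
     intrinsic_dist X (g s) (g t) = c * `|s - t|).

Definition initial_tangent (g : R -> 'rV[R]_M) v : Prop :=
  t^-1 *: (g t - g 0) @[t --> 0^'+] --> v.

(* log_{x'}(x); the geodesic is parametrised by [0, 1], hence has speed
   d(x', x), which makes the norm of its initial tangent vector d(x', x). *)
Definition logmap X x' x : 'rV[R]_M :=
  xget 0 [set v | exists g : R -> 'rV[R]_M,
    [/\ geodesic X (intrinsic_dist X x' x) 1 g, g 0 = x', g 1 = x &
        initial_tangent g v]].

(* x'(lam, w): the point reached at time [lam], that is at distance
   lam * |w|, by a geodesic of speed |w| starting at x' with initial tangent
   vector [w].  Only small positive [lam] matter, for which this point is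
   unique; when there is no such geodesic the value defaults to x'. *)
Definition geodesic_point X x' (lam : R) w : 'rV[R]_M :=
  xget x' [set p | exists g : R -> 'rV[R]_M,
    [/\ geodesic X (enorm w) lam g, g 0 = x', initial_tangent g w &
        p = g lam]].

Definition Phi X x x' : 'rV[R]_M := logmap X x' x + x'.

(* The orthogonal projection onto R(E). *)
Definition orth_proj E v : 'rV[R]_M := \row_i (if i \in E then v 0 i else 0).

Definition Phi_proj E X x x' : 'rV[R]_M := orth_proj E (Phi X x x').

Definition Psi X x w xs : 'rV[R]_M :=
  lim (Phi X x (geodesic_point X xs lam w) @[lam --> 0^'+]).

Definition Psi_proj E X x w xs : 'rV[R]_M := orth_proj E (Psi X x w xs).

(* R(E) x O(F), for disjoint E and F. *)
Definition tangent_vectors E F : set 'rV[R]_M :=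
  [set w | exists v u, [/\ orth_proj E v = v, orthant F u & w = v + u]].

End OrthantSpaces.

(* Main.v *)
(* Condition (b) makes X the set of nonnegative vectors whose support is a clique
   of a graph on the coordinates.  Given p and x in X, call a (with p_a > 0) and
   b (with x_b > 0) in conflict if they are not adjacent.  Let each conflicting
   coordinate a of p shrink linearly to 0 on [0, t_a] and each conflicting
   coordinate b of x grow linearly from 0 on [t_b, 1], the others moving linearly
   on [0, 1].  This path stays in X as soon as t_a <= t_b for all conflicts, and
   the times minimising its (convex) energy yield the geodesic: the optimality
   conditions make the path D-Lipschitz, and they show that the linear form given
   by its slopes is D-Lipschitz for the intrinsic metric and grows by D^2 from p
   to x.  Equality in this calibration also determines the beginning of every
   geodesic, so log_p(x) has the entry - p_a / t_a at a conflicting a, 0 at a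
   conflicting b, and x_i - p_i elsewhere.

   The optimality conditions identify p_a / t_a - p_a with a max-min, over sets S
   containing a, of p_a |x_N(S)| / |p_S|, with N(S) the coordinates in conflict
   with S.  For p = x* + lam w in O(E u F), each quotient p_a / |p_S| has a limit
   as lam -> 0+, which depends only on x* and on the entries of w in F; for a in E
   it is the quotient at x*.  The entries of Phi outside E u F are locally
   constant.  *)
Require Import Defs.
From HB Require Import structures.
From mathcomp Require Import all_boot all_order all_algebra.
From mathcomp Require Import all_classical all_reals all_analysis.
From mathcomp Require Import ring lra.

Set Implicit Arguments.
Unset Strict Implicit.
Unset Printing Implicit Defensive.

Import Order.TTheory GRing.Theory Num.Theory.
Import numFieldNormedType.Exports.

Local Open Scope classical_set_scope.
Local Open Scope ring_scope.

(** * The intrinsic metric *)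

Section EuclideanNorm.
Context {R : realType} {M : nat}.
Implicit Types (v w n : 'rV[R]_M).

Lemma enorm_ge0 v : 0 <= enorm v.
Proof. exact: sqrtr_ge0. Qed.

Lemma sqr_enorm v : enorm v ^+ 2 = \sum_i v 0 i ^+ 2.
Proof. by rewrite sqr_sqrtr// sumr_ge0// => i _; rewrite sqr_ge0. Qed.

Lemma enorm_le v K : 0 <= K -> \sum_i v 0 i ^+ 2 <= K ^+ 2 -> enorm v <= K.
Proof.
by move=> K0; rewrite -sqr_enorm ler_sqr// nnegrE ?enorm_ge0.
Qed.

Lemma coord_le_enorm v i : `|v 0 i| <= enorm v.
Proof.
rewrite -(@ler_pXn2r _ 2) ?nnegrE ?normr_ge0 ?enorm_ge0//.
rewrite sqr_enorm real_normK ?num_real// (bigD1 i)//= lerDl.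
by rewrite sumr_ge0// => j _; rewrite sqr_ge0.
Qed.

Lemma enormZ a v : enorm (a *: v) = `|a| * enorm v.
Proof.
rewrite /enorm -sqrtr_sqr -sqrtrM ?sqr_ge0//; congr Num.sqrt.
by rewrite mulr_sumr; apply: eq_bigr => i _; rewrite mxE exprMn.
Qed.

Lemma enorm_eq0 v : enorm v = 0 -> v = 0.
Proof.
move=> v0; apply/rowP => i; rewrite mxE; apply/normr0_eq0/eqP.
by rewrite eq_le normr_ge0 andbT -[leRHS]v0 coord_le_enorm.
Qed.

(** The norm of [n] enters only through an upper bound [D], which is what a calibration supplies.
    Expand the square of |v| n - D v and divide by D |v|; the two degenerate cases come first. *)
Lemma cauchy_schwarz_le n v D : 0 <= D -> \sum_i n 0 i ^+ 2 <= D ^+ 2 ->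
  \sum_i n 0 i * v 0 i <= D * enorm v.
Proof.
move=> D0 nD.
have [v0|v0] := eqVneq (enorm v) 0.
  rewrite v0 mulr0 big1// => i _.
  by rewrite (enorm_eq0 v0) mxE mulr0.
have [D00|D00] := eqVneq D 0.
  have n0 : n = 0.
    apply/enorm_eq0/eqP; rewrite eq_le enorm_ge0 andbT -D00.
    exact: enorm_le.
  rewrite D00 mul0r n0 big1// => i _.
  by rewrite mxE mul0r.
have Dv : 0 < D * enorm v by rewrite mulr_gt0// lt0r ?v0 ?D00 ?D0 ?enorm_ge0.
set e := enorm v in v0 Dv *.
have : 0 <= \sum_i (e * n 0 i - D * v 0 i) ^+ 2.
  by rewrite sumr_ge0// => i _; rewrite sqr_ge0.
have -> : \sum_i (e * n 0 i - D * v 0 i) ^+ 2 =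
    e ^+ 2 * (\sum_i n 0 i ^+ 2) - 2 * (D * e) * (\sum_i n 0 i * v 0 i)
     + D ^+ 2 * (\sum_i v 0 i ^+ 2).
  rewrite !mulr_sumr -sumrB -big_split/=.
  by apply: eq_bigr => i _; ring.
rewrite -(sqr_enorm v) -/e => h.
rewrite -(ler_pM2l Dv).
have h2 : e ^+ 2 * (\sum_i n 0 i ^+ 2) <= e ^+ 2 * D ^+ 2.
  by rewrite ler_wpM2l// sqr_ge0.
lra.
Qed.

Lemma enormD v w : enorm (v + w) <= enorm v + enorm w.
Proof.
apply: enorm_le; first by rewrite addr_ge0 ?enorm_ge0.
have := @cauchy_schwarz_le v w (enorm v) (enorm_ge0 v).
rewrite sqr_enorm lexx => /(_ isT) h.
have -> : \sum_i (v + w) 0 i ^+ 2 =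
    \sum_i v 0 i ^+ 2 + 2 * (\sum_i v 0 i * w 0 i) + \sum_i w 0 i ^+ 2.
  rewrite mulr_sumr -!big_split/=; apply: eq_bigr => i _.
  by rewrite mxE; ring.
rewrite -!sqr_enorm; lra.
Qed.

End EuclideanNorm.

Lemma max0_lipschitz (R : realDomainType) (a b : R) :
  `|Num.max 0 a - Num.max 0 b| <= `|a - b|.
Proof.
have := ler_norm (a - b); have := ler_norm (b - a); rewrite distrC ler_norml.
by case: (leP 0 a); case: (leP 0 b) => *; lra.
Qed.

Section IntrinsicDistance.
Context {R : realType} {M : nat}.
Implicit Types (X : set 'rV[R]_M) (x y z : 'rV[R]_M) (g : R -> 'rV[R]_M).

Lemma cvg_rowP {T : Type} (F : set_system T) (f : T -> 'rV[R]_M) (l : 'rV[R]_M) :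
  Filter F -> (forall i, f t 0 i @[t --> F] --> l 0 i) -> f t @[t --> F] --> l.
Proof.
move=> FF fl; apply/cvg_ballP => e e0.
have : \forall t \near F, forall i, ball (l 0 i) e (f t 0 i).
  by apply: filter_forall => i; move/cvg_ballP : (fl i); exact.
by apply: filterS => t lt; split=> // i j; rewrite (ord1 i).
Qed.

Lemma lipschitz_continuous_row K g :
  (forall s t, enorm (g s - g t) <= K * `|s - t|) -> continuous g.
Proof.
move=> gK t; apply: cvg_rowP => i.
have K1 : 0 < `|K| + 1 by rewrite ltr_wpDl.
apply/cvgrPdist_lt => /= e e0; near=> s.
have -> : g t 0 i - g s 0 i = (g t - g s) 0 i by rewrite !mxE.
apply: le_lt_trans (coord_le_enorm _ i) _; apply: le_lt_trans (gK _ _) _.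
apply: (@le_lt_trans _ _ ((`|K| + 1) * `|t - s|)).
  by rewrite ler_wpM2r// (le_trans (ler_norm K))// lerDl.
rewrite -ltr_pdivlMl// mulrC; near: s.
by apply: (@cvgr_dist_lt _ _ _ (nbhs t)) => //; rewrite divr_gt0.
Unshelve. all: by end_near. Qed.

Lemma path_length_ge_polygonal g s : itv_partition 0 1 s ->
  ((polygonal_length g s)%:E <= path_length g)%E.
Proof. by move=> s01; apply: ereal_sup_ubound; exists s. Qed.

Lemma path_length_lipschitz K g :
  (forall s t, enorm (g s - g t) <= K * `|s - t|) ->
  (path_length g <= K%:E)%E.
Proof.
move=> gK; apply: ge_ereal_sup => _ [s s01 <-]; rewrite lee_fin.
rewrite /polygonal_length/=.
pose f n : R := nth 1 (0 :: s) n.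
apply: (@le_trans _ _ (\sum_(0 <= n < size s) K * (f n.+1 - f n))).
  rewrite !big_nat; apply: ler_sum => n /andP[_ ns].
  apply: le_trans (gK _ _) _.
  have [ss _] := s01.
  rewrite ger0_norm// subr_ge0 ltW//.
  by have /pathP := ss; apply.
rewrite -mulr_sumr telescope_sumr// /f (itv_partition_nth_size _ s01)/=.
by rewrite subr0 mulr1.
Qed.

Lemma path_in_lipschitz X K g :
  (forall s t, enorm (g s - g t) <= K * `|s - t|) ->
  (forall t, 0 <= t <= 1 -> X (g t)) -> path_in X (g 0) (g 1) g.
Proof.
move=> gK gX; split=> //; apply: continuous_subspaceT.
exact: lipschitz_continuous_row gK.
Qed.

Lemma path_length_ge0 g : (0 <= path_length g)%E.
Proof.
apply: le_trans (path_length_ge_polygonal g (itv_partition1 ltr01)).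
by rewrite lee_fin sumr_ge0// => n _; rewrite enorm_ge0.
Qed.

(** [fine] is faithful only on a finite infimum; here it lies between 0 and the length of [g]. *)
Lemma intrinsic_dist_le X K g :
  (forall s t, enorm (g s - g t) <= K * `|s - t|) ->
  (forall t, 0 <= t <= 1 -> X (g t)) -> intrinsic_dist X (g 0) (g 1) <= K.
Proof.
move=> gK gX; rewrite -lee_fin /intrinsic_dist.
have h : (ereal_inf [set path_length g' | g' in path_in X (g 0%R) (g 1%R)] <= K%:E)%E.
  apply: ge_ereal_inf; exists (path_length g).
    by exists g => //; exact: path_in_lipschitz gK gX.
  exact: path_length_lipschitz.
rewrite fineK// ge0_fin_numE; first exact: le_lt_trans h (ltry _).
by apply: le_ereal_inf_tmp => _ [g' _ <-]; exact: path_length_ge0.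
Qed.

End IntrinsicDistance.

Section Cone.
Context {R : realType} {M : nat} (X : set 'rV[R]_M).
Hypothesis coneX : forall v a, X v -> 0 <= a -> X (a *: v).
Implicit Types (y z : 'rV[R]_M) (g : R -> 'rV[R]_M).

(** [fine] would send an infinite infimum to 0, so a path of finite length from y to z has to be
    exhibited; in a cone there is one through the origin. *)
Lemma intrinsic_dist_ge y z K : X y -> X z ->
  (forall g, path_in X y z g -> (K%:E <= path_length g)%E) ->
  K <= intrinsic_dist X y z.
Proof.
move=> Xy Xz hK; rewrite -lee_fin /intrinsic_dist.
(* From y to 0 on [0, 1/2], then from 0 to z on [1/2, 1]: at each time at most one summand is
   nonzero. *)
pose g (t : R) : 'rV[R]_M :=
  Num.max 0 (1 - 2 * t) *: y + Num.max 0 (2 * t - 1) *: z.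
have gK s t : enorm (g s - g t) <= 2 * (enorm y + enorm z) * `|s - t|.
  have -> : g s - g t =
      (Num.max 0 (1 - 2 * s) - Num.max 0 (1 - 2 * t)) *: y +
      (Num.max 0 (2 * s - 1) - Num.max 0 (2 * t - 1)) *: z.
    by rewrite /g !scalerBl opprD addrACA.
  apply: le_trans (enormD _ _) _; rewrite !enormZ.
  rewrite (_ : 2 * _ * _ = 2 * `|s - t| * enorm y + 2 * `|s - t| * enorm z);
    last by ring.
  apply: lerD; rewrite ler_wpM2r ?enorm_ge0//.
    apply: le_trans (max0_lipschitz _ _) _.
    rewrite (_ : _ - _ - _ = - 2 * (s - t)); last by ring.
    by rewrite normrM normrN (@ger0_norm _ 2).
  apply: le_trans (max0_lipschitz _ _) _.
  rewrite (_ : _ - _ - _ = 2 * (s - t)); last by ring.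
  by rewrite normrM (@ger0_norm _ 2).
have g0 : g 0 = y.
  rewrite /g mulr0 subr0 sub0r (max_r ler01) max_l ?lerN10//.
  by rewrite scale1r scale0r addr0.
have g1 : g 1 = z.
  rewrite /g mulr1 max_l; last by lra.
  rewrite max_r; last by lra.
  have -> : 2 - 1 = 1 :> R by lra.
  by rewrite scale1r scale0r add0r.
have gX t : 0 <= t <= 1 -> X (g t).
  move=> _; have [t2|t2] := leP t (1 / 2).
    rewrite /g [X in _ + X *: _]max_l; last by lra.
    by rewrite scale0r addr0; apply: coneX => //; rewrite le_max lexx.
  rewrite /g max_l; last by lra.
  by rewrite scale0r add0r; apply: coneX => //; rewrite le_max lexx.
have hp := path_in_lipschitz gK gX; rewrite g0 g1 in hp.
rewrite fineK; first by apply: le_ereal_inf_tmp => _ [g' pg' <-]; exact: hK.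
rewrite ge0_fin_numE.
  apply: (@le_lt_trans _ _ (2 * (enorm y + enorm z))%:E); last exact: ltry.
  apply: ge_ereal_inf; exists (path_length g); first by exists g.
  exact: path_length_lipschitz.
by apply: le_ereal_inf_tmp => _ [g' _ <-]; exact: path_length_ge0.
Qed.

Lemma enorm_le_intrinsic_dist y z : X y -> X z ->
  enorm (z - y) <= intrinsic_dist X y z.
Proof.
move=> Xy Xz; apply: intrinsic_dist_ge => // g [_ _ g0 g1].
apply: le_trans (path_length_ge_polygonal g (itv_partition1 ltr01)).
by rewrite lee_fin /polygonal_length big_nat1/= g0 g1.
Qed.

Lemma intrinsic_dist_segment y z : X y -> X z ->
  (forall t, 0 <= t <= 1 -> X (y + t *: (z - y))) ->
  intrinsic_dist X y z = enorm (z - y).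
Proof.
move=> Xy Xz hX; apply/eqP; rewrite eq_le enorm_le_intrinsic_dist// andbT.
pose g (t : R) : 'rV[R]_M := y + t *: (z - y).
have g0 : g 0 = y by rewrite /g scale0r addr0.
have g1 : g 1 = z by rewrite /g scale1r addrC subrK.
rewrite -[in leLHS]g1 -[in leLHS]g0; apply: intrinsic_dist_le => // s t.
by rewrite /g opprD addrACA subrr add0r -scalerBl enormZ mulrC.
Qed.

End Cone.
(** * Calibrations *)

Section Partitions.
Context {R : realType}.
Implicit Types (u : R -> R) (s T : seq R).

(** Positivity being an open condition by the second hypothesis, the infimum of the zeros is a zero.
    Without zeros t = 1 is taken; the bound by [u 1] covers both cases. *)
Lemma first_zero u : (forall t : R, 0 <= t <= 1 -> 0 <= u t) ->
  (forall t : R, 0 <= t <= 1 -> 0 < u t ->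
    exists2 d : R, 0 < d & forall r, 0 <= r <= 1 -> `|r - t| < d -> 0 < u r) ->
  exists t, [/\ 0 <= t <= 1, forall r, 0 <= r < t -> 0 < u r & u t <= u 1].
Proof.
move=> u0 uc.
pose Z := [set t | 0 <= t <= 1 /\ u t = 0].
have [Z0|Zn0] := pselect (Z !=set0); last first.
  exists 1; split=> // [|r /andP[r0 r1]]; first by rewrite ler01 lexx.
  have r01 : 0 <= r <= 1 by rewrite r0 ltW.
  rewrite lt0r u0// andbT; apply/eqP => ur.
  by apply: Zn0; exists r.
have iZ : has_inf Z by split=> //; exists 0 => t [/andP[]].
have inf01 : 0 <= inf Z <= 1.
  apply/andP; split; first by apply: lb_le_inf => // t [/andP[]].
  have [z Zz] := Z0; apply: le_trans (ge_inf iZ.2 Zz) _.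
  by case: Zz => /andP[].
have uinf : u (inf Z) = 0.
  apply/eqP; rewrite eq_le u0// andbT leNgt; apply/negP => ui.
  have [d d0 hd] := uc _ inf01 ui.
  have [z Zz zd] := inf_adherent d0 iZ.
  have := hd z Zz.1; rewrite ger0_norm ?subr_ge0 ?ge_inf ?iZ.2//; last first.
    exact: iZ.2.
  by rewrite ltrBlDl => /(_ zd); rewrite Zz.2 ltxx.
exists (inf Z); split=> // [r /andP[r0 ri]|]; last by rewrite uinf u0 ?ler01 ?lexx.
have r01 : 0 <= r <= 1 by rewrite r0 (le_trans (ltW ri))//; case/andP: inf01.
rewrite lt0r u0// andbT; apply/eqP => ur; move: ri; apply/negP; rewrite -leNgt.
by apply: ge_inf => //; exact: iZ.2.
Qed.

Lemma last_zero u : (forall t : R, 0 <= t <= 1 -> 0 <= u t) ->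
  (forall t : R, 0 <= t <= 1 -> 0 < u t ->
    exists2 d : R, 0 < d & forall r, 0 <= r <= 1 -> `|r - t| < d -> 0 < u r) ->
  exists t, [/\ 0 <= t <= 1, forall r, t < r <= 1 -> 0 < u r & u t <= u 0].
Proof.
move=> u0 uc.
have h (t : R) : 0 <= t <= 1 -> 0 <= 1 - t <= 1 by move=> *; lra.
have [t t01 ut|t [t01 h1 h2]] := @first_zero (fun t => u (1 - t)) (fun t ht => u0 _ (h t ht)).
  have [d d0 hd] := uc _ (h _ t01) ut; exists d => // r r01 rt.
  apply: hd; first exact: h.
  have -> : 1 - r - (1 - t) = t - r by ring.
  by rewrite distrC.
exists (1 - t); split; first exact: h.
- move=> r tr; have := h1 (1 - r).
  by rewrite subKr; apply; lra.
- by move: h2; rewrite subrr.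
Qed.

Lemma itv_partition_through T : {in T, forall t, 0 <= t <= 1} ->
  exists2 s, itv_partition 0 1 s & {subset T <= 0 :: s}.
Proof.
(* [itv_partition] asks for a strictly increasing list that omits the left endpoint 0 and ends at
   1. *)
move=> T01; pose s0 := [seq t <- 1 :: T | 0 < t].
pose s := sort <=%R (undup s0).
have s01 t : t \in s -> 0 < t <= 1.
  rewrite mem_sort mem_undup mem_filter inE => /andP[-> /=].
  by case/orP => [/eqP->//|/T01/andP[]].
have ss : sorted <%R s.
  by rewrite lt_sorted_uniq_le sort_uniq undup_uniq/= sort_le_sorted.
have s1 : 1 \in s by rewrite mem_sort mem_undup mem_filter ltr01 inE eqxx.
exists s; last first.
  move=> t Tt; rewrite inE mem_sort mem_undup mem_filter inE Tt orbT andbT.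
  by have /andP[] := T01 _ Tt; rewrite le0r orbC.
have ps : path <%R 0 s.
  by rewrite lt_path_sortedE ss andbT; apply/allP => t /s01/andP[].
split=> //; rewrite eq_le; apply/andP; split.
  have [->|/s01/andP[]//] : last 0 s = 0 \/ last 0 s \in s.
    have := mem_last 0 s; rewrite inE => /orP[/eqP|]; [by left|by right].
  exact: ler01.
have [k ks <-] := nthP 0 s1.
rewrite (last_nth 0) /=.
case: s ks ss {s1 s01 ps} => //= a s' ks ss.
have := @sorted_leq_nth _ <=%R le_trans lexx 0 (a :: s') (sub_path (@ltW _ R) ss).
by move=> /(_ k (size s')); apply; rewrite ?inE//= -ltnS.
Qed.

(** This keeps the set of coordinates followed along a path constant on each interval of the
    subdivision. *)
Lemma itv_partition_consecutive a b s t k : itv_partition a b s ->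
  t \in a :: s -> (k < size s)%N ->
  t <= nth b (a :: s) k \/ nth b (a :: s) k.+1 <= t.
Proof.
move=> [ps _] /(nthP b)[j js <-] ks.
have mono := @sorted_leq_nth _ <=%R le_trans lexx b (a :: s) (sub_path (@ltW _ R) ps).
have [jk|kj] := leqP j k; [left|right]; apply: mono => //; rewrite inE/=.
by rewrite ltnS ltnW.
Qed.

End Partitions.

Section Calibration.
Context {R : realType} {M : nat} (c : rel 'I_M).

Definition clique_cone : set 'rV[R]_M :=
  [set y | (forall i, 0 <= y 0 i) /\
           (forall i j, 0 < y 0 i -> 0 < y 0 j -> c i j)].

Local Notation X := clique_cone.

Lemma clique_coneZ (v : 'rV[R]_M) a : X v -> 0 <= a -> X (a *: v).
Proof.
move=> [v0 vc]; rewrite le0r => /orP[/eqP->|a0].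
  by split=> [i|i j]; rewrite !mxE mul0r// ltxx.
by split=> [i|i j]; rewrite !mxE ?pmulr_rgt0//; [rewrite pmulr_rge0|exact: vc].
Qed.

(* Along a path, a coordinate with n_i < 0 is followed until its first zero and
   one with n_i >= 0 from its last zero on; the coordinates followed at a given
   time are positive then, so those with n_i < 0 are compatible with those with
   n_i > 0, and the bound on n applies to them. *)
Lemma calibration_le (n : 'rV[R]_M) D y z : 0 <= D ->
  (forall K : {set 'I_M},
    (forall i j, i \in K -> j \in K -> n 0 i < 0 -> 0 < n 0 j -> c i j) ->
    \sum_(i in K) n 0 i ^+ 2 <= D ^+ 2) ->
  X y -> X z ->
  \sum_i n 0 i * (z 0 i - y 0 i) <= D * intrinsic_dist X y z.
Proof.
rewrite le0r => /orP[/eqP-> hn Xy Xz|D0 hn Xy Xz].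
  rewrite mul0r big1// => i _.
  (* A singleton satisfies the compatibility condition vacuously, so D = 0 forces n = 0. *)
  have : \sum_(j in [set i]%SET) n 0 j ^+ 2 <= 0 ^+ 2.
    apply: hn => j k; rewrite !inE => /eqP-> /eqP-> n0.
    by move=> /(lt_trans n0); rewrite ltxx.
  rewrite big_set1 expr0n/= => n0.
  by have /eqP -> : n 0 i == 0; [rewrite -sqrf_eq0 eq_le n0 sqr_ge0|rewrite mul0r].
rewrite -ler_pdivrMl//.
apply: (intrinsic_dist_ge clique_coneZ Xy Xz) => g [gc gX g0 g1].
have coordc i t : 0 <= t <= 1 -> 0 < g t 0 i ->
    exists2 d : R, 0 < d & forall r, 0 <= r <= 1 -> `|r - t| < d -> 0 < g r 0 i.
  move=> t01 gt0; have /(subspace_continuousP _ _) gct := gc.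
  have := gct t; rewrite /= in_itv/= => /(_ t01) /= cg.
  have cgi : g r 0 i @[r --> within `[0, 1] (nbhs t)] --> g t 0 i.
    apply: (cvg_comp _ (fun v : 'rV[R]_M => v 0 i) cg).
    exact: coord_continuous.
  have /cvgrPdist_lt/(_ _ gt0) := cgi.
  move=> /nbhs_ballP[d/= d0 hd]; exists d => // r r01 rt.
  have := hd r; rewrite /ball/= distrC => /(_ rt); rewrite in_itv/= => /(_ r01).
  by rewrite ltr_norml => /andP[_]; rewrite ltrBlDr ltrDl.
have gge0 i t : 0 <= t <= 1 -> 0 <= g t 0 i by move=> /gX[].
have /choice[tau htau] : forall i, exists t,
    [/\ 0 <= t <= 1,
        n 0 i < 0 -> (forall r, 0 <= r < t -> 0 < g r 0 i) /\ g t 0 i <= g 1 0 i &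
        0 <= n 0 i -> (forall r, t < r <= 1 -> 0 < g r 0 i) /\ g t 0 i <= g 0 0 i].
  move=> i; have [n0|n0] := ltP (n 0 i) 0.
    by have [t [? ? ?]] := first_zero (gge0 i) (coordc i); exists t.
  by have [t [? ? ?]] := last_zero (gge0 i) (coordc i); exists t.
have [s s01 taus] : exists2 s, itv_partition 0 1 s &
    {subset [seq tau i | i <- enum 'I_M] <= 0 :: s}.
  by apply: itv_partition_through => _ /mapP[i _ ->]; case: (htau i).
have {taus} taus i : tau i \in 0 :: s.
  by apply: taus; apply: map_f; rewrite mem_enum.
apply: le_trans (path_length_ge_polygonal g s01); rewrite lee_fin.
rewrite ler_pdivrMl// /polygonal_length mulr_sumr/=.
pose f k : R := nth 1 (0 :: s) k.
(* [N k] is [n] cut down to the coordinates followed on the k-th interval, the set [K] below. *)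
pose N k i := if n 0 i < 0 then (if f k < tau i then n 0 i else 0)
              else (if tau i <= f k then n 0 i else 0).
have fS k : (k < size s)%N -> f k < f k.+1.
  by move=> ks; have [/pathP ps _] := s01; exact: ps.
have f01 k : (k < (size s).+1)%N -> 0 <= f k <= 1.
  move=> ks; rewrite (itv_partition_nth_le ks s01).
  by rewrite (itv_partition_nth_ge ks s01).
have ftau k i : (k < size s)%N -> tau i <= f k \/ f k.+1 <= tau i.
  by move=> ks; exact: itv_partition_consecutive s01 (taus i) ks.
apply: (@le_trans _ _ (\sum_(0 <= k < size s)
    \sum_i N k i * (g (f k.+1) - g (f k)) 0 i)); last first.
  rewrite !big_nat; apply: ler_sum => k /andP[_ ks].
  rewrite [leLHS](_ : _ = \sum_i (\row_j N k j) 0 i * (g (f k.+1) - g (f k)) 0 i);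
    last by apply: eq_bigr => i _; rewrite mxE.
  apply: cauchy_schwarz_le; first exact: ltW.
  pose K := [set i | if n 0 i < 0 then f k < tau i else tau i <= f k]%SET.
  have -> : \sum_i (\row_j N k j) 0 i ^+ 2 = \sum_(i in K) n 0 i ^+ 2.
    rewrite [RHS]big_mkcond; apply: eq_bigr => i _; rewrite mxE /N inE.
    by case: ifP => _; case: ifP => _//; rewrite expr0n.
  apply: hn => i j; rewrite !inE => iK jK n0 n1.
  rewrite n0 in iK; rewrite (lt_gtF n1) in jK.
  have {}iK : f k.+1 <= tau i.
    by case: (ftau k i ks) => //; rewrite leNgt iK.
  have := fS k ks; have /andP[fk0 fk1] := f01 k (ltnW ks).
  have /andP[fk0' fk1'] := f01 k.+1 ks => ff.
  (* At the midpoint both coordinates are strictly inside the periods in which they are followed,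
     hence both positive. *)
  pose m := (f k + f k.+1) / 2.
  have m01 : 0 <= m <= 1 by rewrite /m; lra.
  have [_ cm] := gX m m01; apply: cm.
    by have [_ /(_ n0)[+ _] _] := htau i; apply; rewrite /m; lra.
  by have [_ _ /(_ (ltW n1))[+ _]] := htau j; apply; rewrite /m; lra.
(* After exchanging the sums, the terms of i telescope to n_i times the increment of g_i over
   [0, tau_i] or [tau_i, 1]. Comparing g_i at tau_i with its value at the omitted endpoint gives the
   inequality, by the sign of n_i. *)
rewrite exchange_big/=; apply: ler_sum => i _.
have f0 : f 0 = 0 by [].
have fs : f (size s) = 1 by exact: itv_partition_nth_size s01.
have [/andP[t0 t1] hneg hpos] := htau i.
have [n0|n0] := ltP (n 0 i) 0.
  rewrite (eq_big_nat _ _ (F2 := fun k => n 0 i *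
      (g (Num.min (f k.+1) (tau i)) 0 i - g (Num.min (f k) (tau i)) 0 i))).
    rewrite -mulr_sumr telescope_sumr// fs f0 (min_l t0) (min_r t1) g0.
    rewrite ler_nM2l// lerB// -g1.
    by have [] := hneg n0.
  move=> k /andP[_ ks]; rewrite /N n0; case: ifPn => [ft|].
    case: (ftau k i ks) => [|ft']; first by rewrite leNgt ft.
    by rewrite !min_l ?(ltW ft)// !mxE.
  rewrite -leNgt => ft; rewrite !min_r//; first by rewrite subrr mulr0 mul0r.
  exact: le_trans ft (ltW (fS _ ks)).
rewrite (eq_big_nat _ _ (F2 := fun k => n 0 i *
      (g (Num.max (f k.+1) (tau i)) 0 i - g (Num.max (f k) (tau i)) 0 i))).
  rewrite -mulr_sumr telescope_sumr// fs f0 (max_r t0) (max_l t1) g1.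
  rewrite ler_wpM2l// lerB// -g0.
  by have [] := hpos n0.
move=> k /andP[_ ks]; rewrite /N ltNge n0/=; case: ifPn => [ft|].
  rewrite !max_l ?mxE//.
  exact: le_trans ft (ltW (fS _ ks)).
rewrite -ltNge => ft; case: (ftau k i ks) => [|ft']; first by rewrite leNgt ft.
by rewrite !max_r ?(ltW ft)// subrr mulr0 mul0r.
Qed.

End Calibration.
(** * Minimising the energy *)

Section RealSums.
Context {R : realType}.

Lemma cvg_sumr {T I : Type} (F : set_system T) (r : seq I) (P : pred I)
    (f : I -> T -> R) (l : I -> R) : Filter F ->
  (forall i, P i -> f i t @[t --> F] --> l i) ->
  \sum_(i <- r | P i) f i t @[t --> F] --> \sum_(i <- r | P i) l i.
Proof. by move=> FF fl; apply: cvg_big => //; exact: add_continuous. Qed.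

Lemma cvg_perturb (a b : R) : a + e * b @[e --> 0^'+] --> a.
Proof.
apply: cvg_at_right_filter; rewrite -[X in _ --> X]addr0 -[X in _ --> _ + X](mul0r b).
by apply: cvgD; [exact: cvg_cst|apply: cvgM => //; exact: cvg_cst].
Qed.

End RealSums.

Section OptimalTimes.
Context {R : realType} {M : nat}.
Variables (e : rel 'I_M) (p x : 'I_M -> R).

Definition sources : {set 'I_M} := [set a | [exists b, e a b]]%SET.
Definition sinks : {set 'I_M} := [set b | [exists a, e a b]]%SET.

Local Notation A := sources.
Local Notation B := sinks.

(* The energy of the path in which the coordinates a in A decrease linearly from
   p a to 0 on [0, t a] and the coordinates b in B increase linearly from 0 to
   x b on [t b, 1]. *)
Let J (t : 'I_M -> R) : R :=
  \sum_(a in A) p a ^+ 2 / t a + \sum_(b in B) x b ^+ 2 / (1 - t b).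

Hypothesis p_gt0 : forall a, a \in A -> 0 < p a.
Hypothesis x_gt0 : forall b, b \in B -> 0 < x b.

Let edge_source a b : e a b -> a \in A.
Proof. by move=> eab; rewrite inE; apply/existsP; exists b. Qed.

Let edge_sink a b : e a b -> b \in B.
Proof. by move=> eab; rewrite inE; apply/existsP; exists a. Qed.

(** The energy blows up when some t_a tends to 0 or some t_b to 1, so the times can be confined to a
    compact set on which it is continuous. The minimiser stays strictly away from the cut-off [d],
    which leaves room for small variations. *)
Let energy_minimizer : exists t : 'I_M -> R, exists2 d, 0 < d &
  [/\ forall a b, e a b -> t a <= t b,
      forall a, a \in A -> d < t a, forall b, b \in B -> d < 1 - t b &
      forall u : 'I_M -> R, (forall i, 0 <= u i <= 1) ->
        (forall a b, e a b -> u a <= u b) ->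
        (forall a, a \in A -> d <= u a) -> (forall b, b \in B -> d <= 1 - u b) ->
        J t <= J u] /\ (forall i, 0 <= t i <= 1).
Proof.
pose J0 := J (fun=> 2^-1).
(* The constant time 1/2 is an admissible competitor, of energy [J0]. With this [d], a single term
   with t_a = d or 1 - t_b = d exceeds [J0]. *)
have [d [d0 d2 dA dB]] : exists d, [/\ 0 < d, d <= 2^-1,
    forall a, a \in A -> d * J0 < p a ^+ 2 &
    forall b, b \in B -> d * J0 < x b ^+ 2].
  near (0 : R)^'+ => d; exists d; split.
  - by near: d; exact: nbhs_right_gt.
  - by near: d; apply: nbhs_right_le; rewrite invr_gt0.
  - near: d; apply: filter_forall => a.
    have [aA|] := boolP (a \in A); last by move=> _; apply: nearW.
    near=> d => _; near: d.
    apply: (@cvgr_lt _ _ _ _ (fun d => d * J0) 0); last by rewrite exprn_gt0 ?p_gt0.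
    have := @cvg_perturb R 0 J0.
    by under eq_fun do rewrite add0r.
  - near: d; apply: filter_forall => b.
    have [bB|] := boolP (b \in B); last by move=> _; apply: nearW.
    near=> d => _; near: d.
    apply: (@cvgr_lt _ _ _ _ (fun d => d * J0) 0); last by rewrite exprn_gt0 ?x_gt0.
    have := @cvg_perturb R 0 J0.
    by under eq_fun do rewrite add0r.
pose lo i : R := if i \in A then d else 0.
pose hi i : R := if i \in B then 1 - d else 1.
pose C1 := [set t : 'rV[R]_M | forall i, `[lo i, hi i]%classic (t ord0 i)].
pose C2 : set 'rV[R]_M := \bigcap_(ab in [set ab : 'I_M * 'I_M | e ab.1 ab.2])
   [set t : 'rV[R]_M | t 0 ab.1 - t 0 ab.2 <= 0].
have cC1 : compact C1.
  apply: (@rV_compact _ _ (fun i => `[lo i, hi i]%classic)) => i.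
  exact: segment_compact.
have cC2 : closed C2.
  apply: closed_bigI => -[a b] _ /=.
  apply: (@closed_comp _ _ (fun t : 'rV[R]_M => t 0 a - t 0 b) [set r | r <= 0]).
    move=> t _.
    by apply: (@continuousB R R _ (fun v : 'rV[R]_M => v 0 a) (fun v => v 0 b));
      exact: coord_continuous.
  exact: closed_le.
pose C := C1 `&` C2.
have cC : compact C.
  apply: (subclosed_compact _ cC1); last by move=> t [].
  by apply: closedI => //; apply: compact_closed => //; exact: norm_hausdorff.
have inC (u : 'I_M -> R) : (forall i, 0 <= u i <= 1) ->
        (forall a b, e a b -> u a <= u b) ->
        (forall a, a \in A -> d <= u a) -> (forall b, b \in B -> d <= 1 - u b) ->
    C (\row_i u i).
  move=> u01 ue uA uB; split=> [i|[a b]/= eab]; last first.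
    by rewrite !mxE subr_le0 ue.
  rewrite mxE /= in_itv/= /lo /hi; have /andP[ui0 ui1] := u01 i.
  apply/andP; split; first by case: ifP => // /uA.
  by case: ifP => // /uB; rewrite lerBrDl addrC -lerBrDl.
have C0 : C !=set0.
  exists (\row_i 2^-1); apply: inC => //= *; lra.
have Ct i t : C t -> (i \in A -> d <= t 0 i) /\ (i \in B -> d <= 1 - t 0 i).
  move=> [/(_ i) + _]; rewrite /= in_itv/= /lo /hi => /andP[h1 h2].
  split=> h; rewrite h in h1 h2 => //; lra.
have cJ : {within C, continuous (fun t : 'rV[R]_M => J (fun i => t 0 i))}.
  apply: continuous_in_subspaceT => t; rewrite inE => Ct'.
  have ct i : v 0 i @[v --> t] --> t 0 i by exact: coord_continuous.
  suff : J (fun i => v 0 i) @[v --> t] --> J (fun i => t 0 i) by [].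
  apply: cvgD; apply: cvg_sumr => i iS; apply: cvgM; try exact: cvg_cst.
    apply: cvgV; last exact: ct.
    by rewrite gt_eqF// (lt_le_trans d0)// (Ct i t Ct').1.
  apply: cvgV; last by apply: cvgB; [exact: cvg_cst|exact: ct].
  by rewrite gt_eqF// (lt_le_trans d0)// (Ct i t Ct').2.
have [t tC tmin] := EVT_min_rV C0 cC cJ; rewrite inE in tC.
have tJ u : (forall i, 0 <= u i <= 1) ->
        (forall a b, e a b -> u a <= u b) ->
        (forall a, a \in A -> d <= u a) -> (forall b, b \in B -> d <= 1 - u b) ->
        J (fun i => t 0 i) <= J u.
  move=> u01 ue uA uB; have := tmin (\row_i u i).
  rewrite inE => /(_ (inC _ u01 ue uA uB)).
  by have -> : (fun i => (\row_j u j) 0 i) = u by apply/funext => i; rewrite mxE.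
have tJ0 : J (fun i => t 0 i) <= J0 by apply: tJ => // *; lra.
have tA a : a \in A -> 0 < t 0 a by move=> aA; rewrite (lt_le_trans d0)// (Ct a t tC).1.
have tB b : b \in B -> 0 < 1 - t 0 b.
  by move=> bB; rewrite (lt_le_trans d0)// (Ct b t tC).2.
have sumA_ge0 : 0 <= \sum_(a in A) p a ^+ 2 / t 0 a.
  by apply: sumr_ge0 => a aA; rewrite divr_ge0 ?sqr_ge0 ?(ltW (tA _ aA)).
have sumB_ge0 : 0 <= \sum_(b in B) x b ^+ 2 / (1 - t 0 b).
  by apply: sumr_ge0 => b bB; rewrite divr_ge0 ?sqr_ge0 ?(ltW (tB _ bB)).
exists (fun i => t 0 i), d => //; split; [split=> //|].
- by move=> a b eab; have [_ /(_ (a, b) eab)] := tC; rewrite /= subr_le0.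
- move=> a aA; rewrite lt_neqAle (Ct a t tC).1// andbT; apply/eqP => dt.
  have := dA a aA; rewrite -ltr_pdivlMl// mulrC => /(le_lt_trans tJ0).
  apply/negP; rewrite -leNgt /J (bigD1 a)//= -dt -addrA lerDl addr_ge0//.
  by apply: sumr_ge0 => i /andP[iA _]; rewrite divr_ge0 ?sqr_ge0 ?(ltW (tA _ iA)).
- move=> b bB; rewrite lt_neqAle (Ct b t tC).2// andbT; apply/eqP => dt.
  have := dB b bB; rewrite -ltr_pdivlMl// mulrC => /(le_lt_trans tJ0).
  apply/negP; rewrite -leNgt /J [X in _ + X](bigD1 b)//= -dt addrCA lerDl addr_ge0//.
  by apply: sumr_ge0 => i /andP[iA _]; rewrite divr_ge0 ?sqr_ge0 ?(ltW (tB _ iA)).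
- move=> i; have [/(_ i) + _] := tC; rewrite /= in_itv/= /lo /hi.
  by case: ifP => _; case: ifP => _ /andP[? ?]; lra.
Unshelve. all: by end_near. Qed.

(* The last clause is the first-order optimality condition in the directions v
   that respect the active constraints. *)
Lemma optimal_times : exists t : 'I_M -> R,
  [/\ forall a, a \in A -> 0 < t a < 1, forall b, b \in B -> 0 < t b < 1,
      forall a b, e a b -> t a <= t b &
      forall v : 'I_M -> R, (forall a b, e a b -> t a = t b -> v a <= v b) ->
        \sum_(a in A) (p a / t a) ^+ 2 * v a <=
        \sum_(b in B) (x b / (1 - t b)) ^+ 2 * v b].
Proof.
have [t [d d0 [[te tA tB tmin] t01]]] := energy_minimizer.
have tA0 a : a \in A -> 0 < t a by move=> /tA/(lt_trans d0).
have tB0 b : b \in B -> 0 < 1 - t b by move=> /tB/(lt_trans d0).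
exists t; split=> //.
- move=> a aA; rewrite tA0//=; move: aA; rewrite inE => /existsP[b eab].
  by rewrite (le_lt_trans (te _ _ eab))// -subr_gt0 tB0// (edge_sink eab).
- move=> b bB; rewrite -[t b < 1]subr_gt0 tB0// andbT.
  move: bB; rewrite inE => /existsP[a eab].
  by rewrite (lt_le_trans _ (te _ _ eab))// tA0// (edge_source eab).
move=> v ve.
(* Times of indices without conflict are left alone, so that they stay in [0, 1]. *)
pose v' i := if (i \in A) || (i \in B) then v i else 0.
(* The difference quotient of the energy in the direction [v], with the factor h already cancelled
   so that its limit can be read off. *)
pose W h := - (\sum_(a in A) p a ^+ 2 * v a / (t a * (t a + h * v a))) +
  \sum_(b in B) x b ^+ 2 * v b / ((1 - t b) * (1 - t b + h * - v b)).
have cW : W h @[h --> 0^'+] --> - (\sum_(a in A) (p a / t a) ^+ 2 * v a) +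
        \sum_(b in B) (x b / (1 - t b)) ^+ 2 * v b.
  apply: cvgD; [apply: cvgN|]; apply: cvg_sumr => i iS.
    rewrite (_ : (p i / t i) ^+ 2 * v i = p i ^+ 2 * v i / (t i * t i)); last first.
      by field; rewrite gt_eqF ?tA0.
    apply: cvgM; first exact: cvg_cst.
    apply: cvgV; first by rewrite mulf_neq0// gt_eqF ?tA0.
    by apply: cvgM; [exact: cvg_cst|exact: cvg_perturb].
  rewrite (_ : (x i / (1 - t i)) ^+ 2 * v i =
      x i ^+ 2 * v i / ((1 - t i) * (1 - t i))); last first.
    by field; rewrite gt_eqF ?tB0.
  apply: cvgM; first exact: cvg_cst.
  apply: cvgV; first by rewrite mulf_neq0// gt_eqF ?tB0.
  by apply: cvgM; [exact: cvg_cst|exact: cvg_perturb].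
rewrite -subr_ge0 addrC; apply: (cvgr_to_ge cW).
have near_gt (a b z : R) : z < a -> \forall h \near 0^'+, z < a + h * b.
  by move=> za; apply: (cvgr_gt a) => //; exact: cvg_perturb.
near=> h.
have h0 : 0 < h by near: h; exact: nbhs_right_gt.
have hA a : a \in A -> d < t a + h * v a.
  move: a; near: h; apply: filter_forall => a.
  have [aA|] := boolP (a \in A); last by move=> _; apply: nearW.
  by near=> h => _; near: h; apply/near_gt/tA.
have hB b : b \in B -> d < 1 - t b + h * - v b.
  move: b; near: h; apply: filter_forall => b.
  have [bB|] := boolP (b \in B); last by move=> _; apply: nearW.
  by near=> h => _; near: h; apply/near_gt/tB.
(* Active constraints survive by the hypothesis on [v], the others because they are strict and h is
   small. *)
have hE a b : e a b -> t a + h * v a <= t b + h * v b.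
  move=> eab; have := te _ _ eab; rewrite le_eqVlt => /orP[/eqP tab|tab].
    by rewrite tab lerD2l ler_wpM2l ?(ltW h0) ?ve.
  rewrite -subr_ge0 (_ : _ - _ = t b - t a + h * (v b - v a)); last by ring.
  apply/ltW; move: a b eab tab; near: h.
  apply: filter_forall => a; apply: filter_forall => b.
  have [eab|] := boolP (e a b); last by move=> _; apply: nearW.
  have [tab|] := boolP (t a < t b); last by move=> _; apply: nearW.
  by near=> h => _ _; near: h; apply: near_gt; rewrite subr_gt0.
pose u i := t i + h * v' i.
have uA a : a \in A -> u a = t a + h * v a by rewrite /u /v' => ->.
have uB b : b \in B -> 1 - u b = 1 - t b + h * - v b.
  by move=> bB; rewrite /u /v' bB orbT; ring.
have uE a b : e a b -> u a = t a + h * v a /\ u b = t b + h * v b.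
  by move=> eab; rewrite /u /v' (edge_source eab) (edge_sink eab) orbT.
have uE' a b : e a b -> u a <= u b.
  by move=> eab; have [-> ->] := uE _ _ eab; exact: hE.
have uA' a : a \in A -> d <= u a by move=> aA; rewrite uA// ltW// hA.
have uB' b : b \in B -> d <= 1 - u b by move=> bB; rewrite uB// ltW// hB.
have u01 i : 0 <= u i <= 1.
  have [iA|iA] := boolP (i \in A).
    have := iA; rewrite inE => /existsP[b eib].
    have := uA' _ iA; have := uB' _ (edge_sink eib); have := uE' _ _ eib; lra.
  have [iB|iB] := boolP (i \in B).
    have := iB; rewrite inE => /existsP[a eai].
    have := uB' _ iB; have := uA' _ (edge_source eai); have := uE' _ _ eai; lra.
  by rewrite /u /v' (negbTE iA) (negbTE iB) mulr0 addr0.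
have := tmin u u01 uE' uA' uB'; rewrite -subr_ge0.
suff -> : J u - J t = h * W h by rewrite pmulr_rge0.
rewrite /J /W mulrDr mulrN !mulr_sumr opprD addrACA -!sumrB; congr (_ + _).
  rewrite -sumrN; apply: eq_bigr => a aA; rewrite uA//.
  by field; rewrite !gt_eqF ?tA0// (lt_trans d0)// hA.
apply: eq_bigr => b bB; rewrite uB//.
by field; rewrite !gt_eqF ?tB0// (lt_trans d0)// hB.
Unshelve. all: by end_near. Qed.

End OptimalTimes.
(** * The geodesic between two points *)

Section Geodesic.
Context {R : realType} {M : nat}.
Variables (c : rel 'I_M) (p x : 'rV[R]_M).
Hypotheses (csym : symmetric c) (Xp : clique_cone c p) (Xx : clique_cone c x).

Local Notation X := (clique_cone c).

Definition conflict : rel 'I_M := fun a b => [&& 0 < p 0 a, 0 < x 0 b & ~~ c a b].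

Local Notation A := (sources conflict).
Local Notation B := (sinks conflict).

Lemma sourcesP a : reflect (0 < p 0 a /\ exists2 b, 0 < x 0 b & ~~ c a b) (a \in A).
Proof.
rewrite inE; apply: (iffP existsP) => [[b /and3P[pa xb cab]]|[pa [b xb cab]]].
  by split=> //; exists b.
by exists b; apply/and3P.
Qed.

Lemma sinksP b : reflect (0 < x 0 b /\ exists2 a, 0 < p 0 a & ~~ c a b) (b \in B).
Proof.
rewrite inE; apply: (iffP existsP) => [[a /and3P[pa xb cab]]|[xb [a pa cab]]].
  by split=> //; exists a.
by exists a; apply/and3P.
Qed.

(** Otherwise a and some b in conflict with it would both lie in the support of x, which is a
    clique. *)
Lemma source_target0 a : a \in A -> x 0 a = 0.
Proof.
move=> /sourcesP[_ [b xb]]; apply: contraNeq => xa; apply: Xx.2 => //.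
by rewrite lt0r xa Xx.1.
Qed.

Lemma sink_origin0 b : b \in B -> p 0 b = 0.
Proof.
move=> /sinksP[_ [a pa]]; apply: contraNeq => pb; apply: Xp.2 => //.
by rewrite lt0r pb Xp.1.
Qed.

Lemma source_notin_sinks a : a \in A -> a \notin B.
Proof.
by move=> /source_target0 xa; apply/negP => /sinksP[]; rewrite xa ltxx.
Qed.

Lemma big_sources_sinks (f g h : 'I_M -> R) :
  \sum_i (if i \in A then f i else if i \in B then g i else h i) =
  \sum_(i in A) f i + \sum_(i in B) g i
  + \sum_(i | (i \notin A) && (i \notin B)) h i.
Proof.
rewrite !(big_mkcond (fun i => i \in _)) (big_mkcond (fun i => _ && _))/=.
rewrite -!big_split/=; apply: eq_bigr => i _.
have [iA|iA] := boolP (i \in A).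
  by rewrite (negbTE (source_notin_sinks iA)) !addr0.
by case: (i \in B); rewrite /= add0r ?addr0 ?add0r.
Qed.

Variable t : 'I_M -> R.
Hypotheses (tA : forall a, a \in A -> 0 < t a < 1)
  (tB : forall b, b \in B -> 0 < t b < 1)
  (te : forall a b, conflict a b -> t a <= t b).

Let q a := p 0 a / t a.
Let r b := x 0 b / (1 - t b).

Hypothesis tV : forall v : 'I_M -> R,
  (forall a b, conflict a b -> t a = t b -> v a <= v b) ->
  \sum_(a in A) q a ^+ 2 * v a <= \sum_(b in B) r b ^+ 2 * v b.

Definition slope i := if i \in A then - q i else if i \in B then r i else x 0 i - p 0 i.

Definition log_vector : 'rV[R]_M := \row_i (if i \in B then 0 else slope i).

(** The squared speed of the path. At a time s different from all t_i, [balance] applied to the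
    indicator of ]s, 1] trades the sources still moving for the sinks still waiting, which leaves
    all sinks and no sources. *)
Let D2 := \sum_(b in B) r b ^+ 2
  + \sum_(i | (i \notin A) && (i \notin B)) (x 0 i - p 0 i) ^+ 2.
Let D := Num.sqrt D2.

Let D2_ge0 : 0 <= D2.
Proof. by rewrite addr_ge0// sumr_ge0// => i _; rewrite sqr_ge0. Qed.

Let D_ge0 : 0 <= D. Proof. exact: sqrtr_ge0. Qed.

Let sqrD : D ^+ 2 = D2. Proof. by rewrite sqr_sqrtr. Qed.

Let q_gt0 a : a \in A -> 0 < q a.
Proof.
move=> aA; have /sourcesP[pa _] := aA.
by rewrite divr_gt0//; case/andP: (tA aA).
Qed.

Let r_gt0 b : b \in B -> 0 < r b.
Proof.
move=> bB; have /sinksP[xb _] := bB.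
by rewrite divr_gt0// subr_gt0; case/andP: (tB bB).
Qed.

Let qt a : a \in A -> q a * t a = p 0 a.
Proof. by move=> /tA/andP[ta _]; rewrite mulfVK ?gt_eqF. Qed.

Let rt b : b \in B -> r b * (1 - t b) = x 0 b.
Proof. by move=> /tB/andP[_ tb]; rewrite mulfVK ?gt_eqF ?subr_gt0. Qed.

(** A function of the time alone meets the active constraints with equality, so it and its opposite
    are both admissible directions. *)
Let balance (phi : R -> R) :
  \sum_(a in A) q a ^+ 2 * phi (t a) = \sum_(b in B) r b ^+ 2 * phi (t b).
Proof.
apply/eqP; rewrite eq_le tV => [|a b _ ->//]/=; rewrite -lerN2 -!sumrN.
under eq_bigr do rewrite -mulrN.
under [leRHS]eq_bigr do rewrite -mulrN.
by apply: (@tV (fun i => - phi (t i))) => a b _ ->.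
Qed.

Let sum_slope_displacement : \sum_i slope i * (x 0 i - p 0 i) = D2.
Proof.
rewrite (eq_bigr (fun i => if i \in A then q i ^+ 2 * t i else if i \in B then
    r i ^+ 2 * (1 - t i) else (x 0 i - p 0 i) ^+ 2)); last first.
  move=> i _; rewrite /slope; case: ifPn => iA.
    by rewrite (source_target0 iA) sub0r mulrNN -(qt iA); ring.
  case: ifPn => iB; last by rewrite expr2.
  by rewrite (sink_origin0 iB) subr0 -{1}(rt iB); ring.
rewrite big_sources_sinks (balance id) -big_split/=; congr (_ + _).
by apply: eq_bigr => i _; ring.
Qed.

(* Optimality in the direction that raises the times of A `&` K and of B `\` K. *)
Let slope_le (K : {set 'I_M}) :
  (forall i j, i \in K -> j \in K -> slope i < 0 -> 0 < slope j -> c i j) ->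
  \sum_(i in K) slope i ^+ 2 <= D2.
Proof.
move=> hK; rewrite big_mkcond/=.
rewrite (eq_bigr (fun i => if i \in A then q i ^+ 2 * (i \in K)%:R else
   if i \in B then r i ^+ 2 * (i \in K)%:R else
   if i \in K then (x 0 i - p 0 i) ^+ 2 else 0)); last first.
  move=> i _; rewrite /slope; case: ifP => _; case: ifP => _;
    rewrite ?mulr1 ?mulr0 ?sqrrN//; by case: ifP.
rewrite big_sources_sinks; apply: lerD; last first.
  by apply: ler_sum => i _; case: ifP => // _; rewrite sqr_ge0.
have := @tV (fun i => if i \in A then (i \in K)%:R else (i \notin K)%:R).
move=> h; apply: (@le_trans _ _ (\sum_(b in B) r b ^+ 2 * (b \notin K)%:R
   + \sum_(b in B) r b ^+ 2 * (b \in K)%:R)).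
  rewrite lerD2r; move: h => h; apply: le_trans; last first.
    apply: le_trans (h _) _.
      move=> a b eab _; have aA : a \in A by rewrite inE; apply/existsP; exists b.
      have bB : b \in B by rewrite inE; apply/existsP; exists a.
      have bA : b \notin A by apply/negP => /source_notin_sinks; rewrite bB.
      rewrite aA (negbTE bA) ler_nat; case: (boolP (a \in K)) => //= aK.
      case: (boolP (b \in K)) => //= bK.
      have /and3P[_ _ /negP] := eab; case; apply: hK => //.
        by rewrite /slope aA oppr_lt0 q_gt0.
      by rewrite /slope (negbTE bA) bB r_gt0.
    apply: ler_sum => b bB; case: ifPn => // bA.
    by move: (source_notin_sinks bA); rewrite bB.
  by apply: ler_sum => a ->.
rewrite -big_split/=; apply: ler_sum => b _.
by case: (b \in K); rewrite ?mulr0 ?mulr1 ?add0r ?addr0.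
Qed.

(** Passing to the opposite form exchanges the two indices in the compatibility condition, which the
    symmetry of [c] absorbs. *)
Let slope_calibrates y z : X y -> X z ->
  `|\sum_i slope i * (z 0 i - y 0 i)| <= D * intrinsic_dist X y z.
Proof.
move=> Xy Xz; rewrite ler_norml; apply/andP; split.
  rewrite lerNl -sumrN.
  rewrite (eq_bigr (fun i => (\row_j - slope j) 0 i * (z 0 i - y 0 i))).
    apply: calibration_le => // K hK; under eq_bigr do rewrite mxE sqrrN.
    rewrite sqrD; apply: slope_le => i j iK jK i0 j0; rewrite csym.
    by apply: hK => //; rewrite mxE ?oppr_lt0 ?oppr_gt0.
  by move=> i _; rewrite mxE mulNr.
rewrite (eq_bigr (fun i => (\row_j slope j) 0 i * (z 0 i - y 0 i))).
  apply: calibration_le => // K hK; under eq_bigr do rewrite mxE.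
  rewrite sqrD; apply: slope_le => i j iK jK i0 j0.
  by apply: hK => //; rewrite mxE.
by move=> i _; rewrite mxE.
Qed.

Definition geodesic_path (s : R) : 'rV[R]_M := \row_i
  (if i \in A then q i * Num.max 0 (t i - s)
   else if i \in B then r i * Num.max 0 (s - t i)
   else p 0 i + s * (x 0 i - p 0 i)).

Local Notation gamma := geodesic_path.

Let gamma0 : gamma 0 = p.
Proof.
apply/rowP => i; rewrite mxE; case: ifPn => iA.
  by rewrite subr0 max_r ?qt//; case/andP: (tA iA) => /ltW.
case: ifPn => iB; last by rewrite mul0r addr0.
rewrite sub0r max_l ?oppr_le0; first by rewrite mulr0 sink_origin0.
by case/andP: (tB iB) => /ltW.
Qed.

Let gamma1 : gamma 1 = x.
Proof.
apply/rowP => i; rewrite mxE; case: ifPn => iA.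
  rewrite max_l ?subr_le0; first by rewrite mulr0 source_target0.
  by case/andP: (tA iA) => _ /ltW.
case: ifPn => iB; last by rewrite mul1r addrC subrK.
by rewrite max_r ?rt// subr_ge0; case/andP: (tB iB) => _ /ltW.
Qed.

Let gamma_in s : 0 <= s <= 1 -> X (gamma s).
Proof.
move=> /andP[s0 s1].
have s1' : 0 <= 1 - s by rewrite subr_ge0.
split=> [i|i j].
  rewrite mxE; case: ifPn => iA.
    by rewrite mulr_ge0 ?(ltW (q_gt0 iA))// le_max lexx.
  case: ifPn => iB; first by rewrite mulr_ge0 ?(ltW (r_gt0 iB))// le_max lexx.
  rewrite (_ : _ + _ = (1 - s) * p 0 i + s * x 0 i); last by ring.
  by rewrite addr_ge0// mulr_ge0// ?Xp.1 ?Xx.1.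
(* A coordinate positive at time s comes from p and has not vanished yet, or belongs to x and has
   already started. Two of the same kind are compatible because the supports of p and x are cliques;
   a conflict between different kinds would give t_l < s < t_k against [te]. *)
have role k : 0 < gamma s 0 k -> (0 < p 0 k /\ (k \in A -> s < t k)) \/
    (0 < x 0 k /\ (k \in B -> t k < s)).
  rewrite mxE; case: ifPn => [kA|kA].
    rewrite pmulr_rgt0 ?q_gt0// lt_max ltxx subr_gt0 => st; left.
    by have /sourcesP[] := kA.
  case: ifPn => [kB|kB].
    rewrite pmulr_rgt0 ?r_gt0// lt_max ltxx subr_gt0 => st; right.
    by have /sinksP[] := kB.
  have [pk _|pk] := ltP 0 (p 0 k); first by left.
  have -> : p 0 k = 0 by apply/eqP; rewrite eq_le pk Xp.1.
  rewrite add0r subr0 => h; right; split=> //.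
  by rewrite lt0r Xx.1 andbT; apply: contraTneq h => ->; rewrite mulr0 ltxx.
have mixed k l : (0 < p 0 k /\ (k \in A -> s < t k)) ->
    (0 < x 0 l /\ (l \in B -> t l < s)) -> c k l.
  move=> [pk sk] [xl sl]; apply: contraT => ckl.
  have ekl : conflict k l by apply/and3P.
  have kA : k \in A by apply/sourcesP; split=> //; exists l.
  have lB : l \in B by apply/sinksP; split=> //; exists k.
  by have := lt_trans (sl lB) (sk kA); rewrite ltNge te.
move=> /role[pi|xi] /role[pj|xj].
- by apply: Xp.2; [case: pi|case: pj].
- exact: mixed.
- by rewrite csym; exact: mixed.
- by apply: Xx.2; [case: xi|case: xj].
Qed.

(** Here f is the signed part of the time from s to u spent before t_i, and u - s - f the part spent
    after it. *)
Let gammaB s u i : (gamma u - gamma s) 0 i =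
  let f := Num.min u (t i) - Num.min s (t i) in
  if i \in A then - (q i * f) else if i \in B then r i * (u - s - f)
  else (u - s) * (x 0 i - p 0 i).
Proof.
have max1 w : Num.max 0 (t i - w) = t i - Num.min w (t i).
  by case: (leP w (t i)) => ?; [rewrite max_r|rewrite max_l]; lra.
have max2 w : Num.max 0 (w - t i) = w - Num.min w (t i).
  by case: (leP w (t i)) => ?; [rewrite max_l|rewrite max_r]; lra.
rewrite !mxE/=; case: ifP => _; first by rewrite !max1; ring.
by case: ifP => _; rewrite ?max2; ring.
Qed.

(* Each phase of the path lasts a fraction of the time |u - s|; the squares of
   these fractions are at most the fractions, for which [balance] applies. *)
Let gamma_lipschitz u s : enorm (gamma u - gamma s) <= D * `|u - s|.
Proof.
apply: enorm_le; first by rewrite mulr_ge0.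
rewrite exprMn sqrD real_normK ?num_real//.
pose f w := Num.min u w - Num.min s w.
have f1 w : 0 <= f w * (u - s - f w).
  by rewrite /f; case: (leP u w) => ?; case: (leP s w) => ?; nra.
have -> : \sum_i (gamma u - gamma s) 0 i ^+ 2 =
    \sum_i (if i \in A then q i ^+ 2 * f (t i) ^+ 2
            else if i \in B then r i ^+ 2 * (u - s - f (t i)) ^+ 2
            else (u - s) ^+ 2 * (x 0 i - p 0 i) ^+ 2).
  apply: eq_bigr => i _; rewrite gammaB/= -/(f _).
  by case: ifP => _; last case: ifP => _; rewrite ?sqrrN exprMn.
rewrite big_sources_sinks mulrDl mulr_suml -mulr_sumr [X in _ <= _ + X]mulrC lerD2r.
apply: (@le_trans _ _ (\sum_(a in A) q a ^+ 2 * ((u - s) * f (t a))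
   + \sum_(b in B) r b ^+ 2 * (u - s - f (t b)) ^+ 2)).
  rewrite lerD2r; apply: ler_sum => a _; rewrite ler_wpM2l ?sqr_ge0//.
  have := f1 (t a); lra.
rewrite (balance (fun w => (u - s) * f w)) -big_split/=.
apply: ler_sum => b _; rewrite -mulrDr ler_wpM2l ?sqr_ge0//.
have := f1 (t b); lra.
Qed.

Let sum_slope_gamma s u :
  \sum_i slope i * (gamma u 0 i - gamma s 0 i) = (u - s) * D2.
Proof.
pose f w := Num.min u w - Num.min s w.
rewrite (eq_bigr (fun i => if i \in A then q i ^+ 2 * f (t i)
            else if i \in B then r i ^+ 2 * (u - s - f (t i))
            else (u - s) * (x 0 i - p 0 i) ^+ 2)); last first.
  move=> i _; have := gammaB s u i; rewrite !mxE/= -/(f _) => ->.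
  by rewrite /slope; case: ifP => _; last case: ifP => _; ring.
rewrite big_sources_sinks (balance f) -mulr_sumr mulrDr -big_split/=.
congr (_ + _); rewrite mulr_sumr; apply: eq_bigr => b _; ring.
Qed.

(** The Lipschitz bound on the reparametrised piece gives one inequality. For the other, the form
    grows by D^2 |s - u| and by at most D times the distance. *)
Let dist_gamma s u : 0 <= s <= 1 -> 0 <= u <= 1 ->
  intrinsic_dist X (gamma s) (gamma u) = D * `|s - u|.
Proof.
move=> s01 u01.
pose g w := gamma (s + w * (u - s)).
have g01 w : 0 <= w <= 1 -> X (g w).
  by move=> w01; apply: gamma_in; nra.
have gK w w' : enorm (g w - g w') <= D * `|s - u| * `|w - w'|.
  apply: le_trans (gamma_lipschitz _ _) _.
  rewrite -mulrA -normrM ler_wpM2l// (_ : s + _ - _ = (u - s) * (w - w')); last by ring.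
  by rewrite !normrM (distrC s).
have := intrinsic_dist_le gK g01.
rewrite /g mul0r addr0 mul1r addrC subrK => le1.
apply/eqP; rewrite eq_le le1/=.
have := slope_calibrates (gamma_in s01) (gamma_in u01).
rewrite sum_slope_gamma normrM (ger0_norm D2_ge0) -sqrD distrC.
(* D cannot be cancelled if it is 0; then only nonnegativity of the distance is left to show. *)
have [->|D0] := eqVneq D 0.
  rewrite !mul0r => _; apply: le_trans (enorm_ge0 (gamma u - gamma s)) _.
  by apply: enorm_le_intrinsic_dist (gamma_in _) (gamma_in _) => //; exact: clique_coneZ.
by rewrite expr2 mulrCA ler_pM2l ?lt0r ?D0// => h; rewrite mulrC.
Qed.

Let dist_px : intrinsic_dist X p x = D.
Proof.
have := @dist_gamma 0 1; rewrite gamma0 gamma1 sub0r normrN1 mulr1.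
by apply; rewrite ?lexx ler01.
Qed.

Let gamma_geodesic : geodesic X (intrinsic_dist X p x) 1 gamma.
Proof. by split=> [s|s u]; [exact: gamma_in|rewrite dist_px; exact: dist_gamma]. Qed.

(** For small s the sources are still positive at g s, so the conflicting sinks vanish there.
    Calibrating from g s to x then gives <L, g s - p> >= D^2 s with L the [log_vector]. Since |L| <=
    D and |g s - p| <= D s, expanding the square of g s - p - s L leaves at most 0. *)
Let geodesic_initially_straight g :
  geodesic X (intrinsic_dist X p x) 1 g -> g 0 = p -> g 1 = x ->
  \forall s \near 0^'+, g s = p + s *: log_vector.
Proof.
rewrite dist_px => -[gX gD] g0 g1.
have small : \forall s \near 0^'+, forall a, a \in A -> D * s < p 0 a.
  apply: filter_forall => a.
  have [/sourcesP[pa _]|] := boolP (a \in A); last by move=> _; apply: nearW.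
  have := @cvg_perturb R 0 D; under eq_fun do rewrite add0r mulrC.
  by move=> /cvgr_lt/(_ _ pa); apply: filterS.
near=> s.
have s0 : 0 < s by near: s; exact: nbhs_right_gt.
have s1 : s <= 1 by near: s; exact: nbhs_right_le.
have s01 : 0 <= s <= 1 by rewrite (ltW s0).
have Xg := gX s s01.
have Dle : enorm (g s - p) <= D * s.
  have <- : D * `|0 - s| = D * s by rewrite sub0r normrN gtr0_norm.
  rewrite -gD ?lexx ?ler01// g0.
  by apply: enorm_le_intrinsic_dist => //; exact: clique_coneZ.
have gA a : a \in A -> 0 < g s 0 a.
  move=> aA; have : D * s < p 0 a.
    by move: a aA; near: s.
  have := le_trans (coord_le_enorm (g s - p) a) Dle.
  rewrite !mxE ler_norml => /andP[]; lra.
have gB b : b \in B -> g s 0 b = 0.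
  move=> /sinksP[xb [a pa cab]]; have aA : a \in A by apply/sourcesP; split=> //; exists b.
  apply: contraNeq cab => gb; apply: Xg.2; first exact: gA.
  by rewrite lt0r gb Xg.1.
have h : D2 * s <= \sum_i log_vector 0 i * (g s - p) 0 i.
  have dgx : intrinsic_dist X (g s) x = D * `|s - 1|.
    by have := gD s 1 s01; rewrite g1 ler01 lexx; apply.
  have := slope_calibrates Xg Xx; rewrite dgx ler_norml => /andP[_].
  have -> : \sum_i slope i * (x 0 i - g s 0 i) = D2 -
      \sum_i log_vector 0 i * (g s - p) 0 i.
    rewrite -sum_slope_displacement -sumrB; apply: eq_bigr => i _; rewrite !mxE.
    case: ifPn => iB; last by ring.
    by rewrite (gB _ iB) (sink_origin0 iB) mul0r !subr0.
  rewrite distrC ger0_norm ?subr_ge0// mulrA -expr2 sqrD; lra.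
(* By [balance] for a constant function, the sources contribute as much as the sinks. *)
have n2 : \sum_i log_vector 0 i ^+ 2 <= D2.
  rewrite (eq_bigr (fun i => if i \in A then q i ^+ 2 * (fun=> 1) (t i) else
     if i \in B then 0 else (x 0 i - p 0 i) ^+ 2)); last first.
    move=> i _; rewrite mxE /slope mulr1; case: ifPn => iB.
      case: ifPn => [/source_notin_sinks|]; first by rewrite iB.
      by rewrite expr0n.
    by rewrite ?(negbTE iB); case: ifP => _; rewrite ?sqrrN.
  rewrite big_sources_sinks (balance (fun=> 1)) [X in _ + X + _]big1// addr0.
  by rewrite lerD2r; apply: ler_sum => b _; rewrite mulr1.
have : \sum_i (g s - p - s *: log_vector) 0 i ^+ 2 <= 0.
  have -> : \sum_i (g s - p - s *: log_vector) 0 i ^+ 2 =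
      \sum_i (g s - p) 0 i ^+ 2 - 2 * s * \sum_i log_vector 0 i * (g s - p) 0 i
      + s ^+ 2 * \sum_i log_vector 0 i ^+ 2.
    rewrite !mulr_sumr -sumrB -big_split/=; apply: eq_bigr => i _; rewrite !mxE.
    ring.
  have : \sum_i (g s - p) 0 i ^+ 2 <= D2 * s ^+ 2.
    rewrite -sqr_enorm -sqrD -exprMn ler_sqr ?nnegrE ?enorm_ge0//.
    by rewrite mulr_ge0// ltW.
  have : s ^+ 2 * \sum_i log_vector 0 i ^+ 2 <= s ^+ 2 * D2.
    by rewrite ler_wpM2l ?sqr_ge0.
  have : 2 * s * (D2 * s) <= 2 * s * \sum_i log_vector 0 i * (g s - p) 0 i.
    by rewrite ler_wpM2l// mulr_ge0// ltW.
  lra.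
rewrite -sqr_enorm => h0; have : enorm (g s - p - s *: log_vector) = 0.
  by apply/eqP; rewrite -sqrf_eq0 eq_le h0 sqr_ge0.
by move/enorm_eq0/eqP; rewrite subr_eq0 subr_eq addrC => /eqP.
Unshelve. all: by end_near. Qed.

Let geodesic_initial_tangent g :
  geodesic X (intrinsic_dist X p x) 1 g -> g 0 = p -> g 1 = x ->
  initial_tangent g log_vector.
Proof.
move=> gg g0 g1; apply: cvg_near_cst; near=> s.
have s0 : 0 < s by near: s; exact: nbhs_right_gt.
have -> : g s = p + s *: log_vector.
  by near: s; exact: geodesic_initially_straight.
by rewrite g0 addrAC subrr add0r scalerA mulVf ?scale1r// gt_eqF.
Unshelve. all: by end_near. Qed.

(** The choice made by [xget] is determined because every geodesic from p to x has this same initial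
    tangent. *)
Lemma logmap_vector : logmap X p x = log_vector.
Proof.
apply: xget_unique.
  exists gamma; split; [exact: gamma_geodesic|exact: gamma0|exact: gamma1|].
  exact: geodesic_initial_tangent gamma_geodesic gamma0 gamma1.
move=> v [g [gg g0 g1 gv]].
have gl := geodesic_initial_tangent gg g0 g1.
exact: (cvg_unique (@norm_hausdorff _ _) gv gl).
Qed.

End Geodesic.
(** * The max-min formula for the logarithm *)

Section SaddleFormula.
Context {R : realType} {M : nat} (c : rel 'I_M).
Implicit Types (p x : 'rV[R]_M) (S L : {set 'I_M}) (w : {set 'I_M} -> R).

Definition conflicting S : {set 'I_M} := [set b | [exists a in S, ~~ c a b]]%SET.

Lemma conflictingP S b : reflect (exists2 a, a \in S & ~~ c a b) (b \in conflicting S).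
Proof. by rewrite inE; exact: exists_inP. Qed.

Definition weight p e S : R := p 0 e ^+ 2 / \sum_(a in S) p 0 a ^+ 2.

Definition saddle_term x w L S : R :=
  Num.sqrt (w S * \sum_(b in conflicting S :\: conflicting L) x 0 b ^+ 2).

(** L stands for indices whose conflicts are discounted. Both default values are harmless: the terms
    are nonnegative, and the singleton of e is itself an admissible S. The squared quotients are a
    parameter [w], so that their limits can be substituted for them. *)
Definition saddle_value x w e : R :=
  \big[Num.max/0]_(L : {set 'I_M} | e \notin L)
    \big[Num.min/saddle_term x w L [set e]%SET]_(S : {set 'I_M} |
      (e \in S) && [disjoint S & L]%B) saddle_term x w L S.

Lemma saddle_valueP x w e v : 0 <= v ->
  (exists2 L : {set 'I_M}, e \notin L &
    forall S : {set 'I_M}, e \in S -> [disjoint S & L]%B -> v <= saddle_term x w L S) ->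
  (forall L : {set 'I_M}, e \notin L -> exists S : {set 'I_M},
    [/\ e \in S, [disjoint S & L]%B & saddle_term x w L S <= v]) ->
  saddle_value x w e = v.
Proof.
move=> v0 [L0 eL0 L0v] vS; apply/eqP; rewrite eq_le; apply/andP; split.
  apply/bigmax_leP; split=> // L eL; have [S [eS SL Sv]] := vS L eL.
  by apply: (@bigmin_inf _ _ _ _ S); rewrite ?eS.
apply: (@bigmax_sup _ _ _ _ L0) => //; apply/bigmin_geP; split.
  by apply: L0v; rewrite ?inE// disjoints1.
by move=> S /andP[eS SL]; exact: L0v.
Qed.

Section SourceValue.
Variables (p x : 'rV[R]_M).
Hypotheses (Xp : clique_cone c p) (Xx : clique_cone c x).

Local Notation conflict := (conflict c p x).
Local Notation A := (sources conflict).
Local Notation B := (sinks conflict).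

Variable t : 'I_M -> R.
Hypotheses (tA : forall a, a \in A -> 0 < t a < 1)
  (tB : forall b, b \in B -> 0 < t b < 1)
  (te : forall a b, conflict a b -> t a <= t b)
  (tV : forall v : 'I_M -> R,
    (forall a b, conflict a b -> t a = t b -> v a <= v b) ->
    \sum_(a in A) (p 0 a / t a) ^+ 2 * v a
      <= \sum_(b in B) (x 0 b / (1 - t b)) ^+ 2 * v b).

Let rho i := (t i)^-1 - 1.

Let sqr_q a : a \in A ->
  (p 0 a / t a) ^+ 2 * (1 - t a) ^+ 2 = rho a ^+ 2 * p 0 a ^+ 2.
Proof. by move=> /tA/andP[ta _]; rewrite /rho; field; rewrite gt_eqF. Qed.

Let sqr_r b : b \in B -> (x 0 b / (1 - t b)) ^+ 2 * (1 - t b) ^+ 2 = x 0 b ^+ 2.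
Proof. by move=> /tB/andP[_ tb]; field; rewrite gt_eqF ?subr_gt0. Qed.

Let rho_ge0 a : a \in A -> 0 <= rho a.
Proof. by move=> /tA/andP[t0 t1]; rewrite subr_ge0 invf_ge1// ltW. Qed.

Let rho_le a b : a \in A -> b \in A -> t a <= t b -> rho b ^+ 2 <= rho a ^+ 2.
Proof.
move=> aA bA tab; rewrite ler_sqr ?nnegrE ?rho_ge0// lerB// lef_pV2 ?posrE//.
  by case/andP: (tA bA).
by case/andP: (tA aA).
Qed.

Let conflict_source a b : conflict a b -> a \in A.
Proof. by move=> eab; rewrite inE; apply/existsP; exists b. Qed.

Let conflict_sink a b : conflict a b -> b \in B.
Proof. by move=> eab; rewrite inE; apply/existsP; exists a. Qed.

Let sink_notin_sources b : b \in B -> b \notin A.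
Proof. by move=> bB; apply/negP => /(source_notin_sinks Xx); rewrite bB. Qed.

(* The set L realising the maximum consists of the a that vanish after e (or have
   no conflict), and the S realising the minimum for L of those outside L that
   vanish no earlier than e.  Both bounds are the optimality condition for the
   direction (1 - t)^2, which turns the slopes into multiples of p and x. *)
Lemma saddle_value_source e : e \in A ->
  saddle_value x (weight p e) e = p 0 e / t e - p 0 e.
Proof.
move=> eA; have /(sourcesP _ _ _ _)[pe _] := eA.
have -> : p 0 e / t e - p 0 e = p 0 e * rho e by rewrite /rho; ring.
have v0 : 0 <= p 0 e * rho e by rewrite mulr_ge0 ?rho_ge0// ltW.
have sum_gt0 S : e \in S -> 0 < \sum_(a in S) p 0 a ^+ 2.
  move=> eS; rewrite (bigD1 e)//= ltr_pwDl ?exprn_gt0//.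
  by rewrite sumr_ge0// => i _; rewrite sqr_ge0.
apply: saddle_valueP => //.
  pose L := [set a | (0 < p 0 a) && ~~ ((a \in A) && (t a <= t e))]%SET.
  exists L => [|S eS SL]; first by rewrite inE pe eA lexx.
  have SLP a : a \in S -> 0 < p 0 a -> (a \in A) && (t a <= t e).
    move=> aS pa; have := disjointFr SL aS; rewrite inE pa => /negbT.
    by rewrite negbK.
  rewrite -[leLHS]ger0_norm// -sqrtr_sqr ler_wsqrtr// /weight exprMn -mulrA.
  rewrite ler_wpM2l ?sqr_ge0// ler_pdivlMl ?sum_gt0//.
  set N := conflicting S :\: conflicting L.
  pose v i := if i \in A then (i \in S)%:R * (1 - t i) ^+ 2
              else (i \in N)%:R * (1 - t i) ^+ 2.
  (* If a in S ties with b, then b is not in conflict with L: a conflicting a' would vanish no later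
     than t_b = t_a <= t_e, which excludes it from L. *)
  have /tV : forall a b, conflict a b -> t a = t b -> v a <= v b.
    move=> a b eab tab; rewrite /v (conflict_source eab).
    rewrite (negbTE (sink_notin_sources (conflict_sink eab))) tab.
    rewrite ler_wpM2r ?sqr_ge0// ler_nat; have [aS|//] := boolP (a \in S).
    have /and3P[pa xb cab] := eab; have /andP[_ tae] := SLP _ aS pa.
    rewrite lt0b; apply/setDP; split; first by apply/conflictingP; exists a.
    apply/negP => /conflictingP[a' a'L ca'b]; move: a'L; rewrite inE => /andP[pa'].
    have ea'b : conflict a' b by apply/and3P.
    by rewrite (conflict_source ea'b)/= (le_trans (te ea'b))// -tab.
  (* Sources in S have t_a <= t_e, hence rho_a >= rho_e; entries of p in S outside the sources are
     0. *)
  move=> h; apply: le_trans (le_trans h _).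
    rewrite mulr_suml [leLHS]big_mkcond [leRHS]big_mkcond/=.
    apply: ler_sum => i _; case: ifPn => [iS|_]; last first.
      case: ifP => // _; rewrite /v mulr_ge0 ?sqr_ge0//.
      by case: ifP => _; rewrite mulr_ge0 ?sqr_ge0.
    rewrite /v iS; case: ifPn => iA; last first.
      have [/(SLP _ iS)|] := ltP 0 (p 0 i); first by rewrite (negbTE iA).
      move=> pi; have -> : p 0 i = 0 by apply/eqP; rewrite eq_le pi Xp.1.
      by rewrite expr0n mul0r.
    rewrite iA mul1r sqr_q// mulrC ler_wpM2r ?sqr_ge0// rho_le//.
    have /(sourcesP _ _ _ _)[pi _] := iA.
    by have /andP[] := SLP _ iS pi.
  rewrite [leLHS]big_mkcond [leRHS]big_mkcond/=; apply: ler_sum => i _.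
  case: ifPn => iB; last by case: ifP => //; rewrite sqr_ge0.
  rewrite /v (negbTE (sink_notin_sources iB)) mulrCA sqr_r//.
  by case: ifP => _; rewrite ?mul1r ?mul0r.
move=> L eL.
pose S := ([set a in A | t e <= t a] :\: L)%SET.
have SA a : a \in S -> [/\ a \in A, t e <= t a & a \notin L].
  by rewrite !inE => /andP[aL /andP[aA ta]].
have eS : e \in S by rewrite !inE eL lexx andbT; move: eA; rewrite inE.
exists S; split=> //.
  rewrite finset.disjoints_subset; apply/fintype.subsetP => a /SA[_ _ aL].
  by rewrite !inE.
rewrite -[leRHS]ger0_norm// -sqrtr_sqr ler_wsqrtr// /weight exprMn -mulrA.
rewrite ler_wpM2l ?sqr_ge0// ler_pdivrMl ?sum_gt0//.
set N := conflicting S :\: conflicting L.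
(* The sign reverses the optimality inequality. Every sink in conflict with S has time at least t_e,
   so its sum over N is bounded by the one over S, where now rho_a <= rho_e. *)
pose v i := - (if i \in A then (i \in S)%:R * (1 - t i) ^+ 2
     else ((t e <= t i) && (i \notin conflicting L))%:R * (1 - t i) ^+ 2).
have /tV : forall a b, conflict a b -> t a = t b -> v a <= v b.
  move=> a b eab tab; rewrite /v (conflict_source eab).
  rewrite (negbTE (sink_notin_sources (conflict_sink eab))) tab lerN2.
  rewrite ler_wpM2r ?sqr_ge0// ler_nat.
  case: (boolP (t e <= t b)) => //= teb; case: (boolP (b \in _)) => //= bL.
  have /and3P[pa xb cab] := eab.
  rewrite lt0b !inE tab teb andbT; have := conflict_source eab; rewrite inE => ->.
  by rewrite andbT; apply: contra bL => aL; apply/conflictingP; exists a.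
rewrite -lerN2 => h; apply: le_trans (le_trans h _).
  rewrite -sumrN [leLHS]big_mkcond [leRHS]big_mkcond/=; apply: ler_sum => i _.
  case: ifPn => iN; last first.
    case: ifP => // _; rewrite /v mulrN opprK mulr_ge0 ?sqr_ge0//.
    by case: ifP => _; rewrite mulr_ge0 ?sqr_ge0.
  move: iN => /setDP[/conflictingP[a /SA[aA tea aL] cai] iL].
  have [->|xi] := eqVneq (x 0 i) 0.
    rewrite expr0n/=; case: ifP => // _; rewrite /v mulrN opprK mulr_ge0 ?sqr_ge0//.
    by case: ifP => _; rewrite mulr_ge0 ?sqr_ge0.
  have eai : conflict a i.
    have /(sourcesP _ _ _ _)[pa _] := aA.
    by apply/and3P; split=> //; rewrite lt0r xi Xx.1.
  have iB := conflict_sink eai.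
  rewrite iB /v (negbTE (sink_notin_sources iB)) mulrN opprK.
  by rewrite (le_trans tea (te eai)) iL mul1r sqr_r.
rewrite -sumrN mulr_suml [leLHS]big_mkcond [leRHS]big_mkcond/=.
apply: ler_sum => i _; rewrite /v mulrN opprK.
case: ifPn => iA; last by case: ifP => // _; rewrite mulr_ge0 ?sqr_ge0.
rewrite iA; have [iS|_] := boolP (i \in S); last by rewrite mul0r mulr0.
rewrite mul1r sqr_q// mulrC ler_wpM2l ?sqr_ge0//.
by have [_ tei _] := SA _ iS; exact: rho_le.
Qed.

End SourceValue.

End SaddleFormula.

(** * Coordinates of Phi, and short geodesics *)

Section LogFormula.
Context {R : realType} {M : nat} (c : rel 'I_M).
Hypothesis csym : symmetric c.
Implicit Types (p x : 'rV[R]_M).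

(** Sources and sinks are eliminated in favour of the support of p, so that the case distinction can
    be followed as p varies. *)
Lemma PhiE p x : clique_cone c p -> clique_cone c x ->
  Phi (clique_cone c) x p = \row_e
    (if 0 < p 0 e then x 0 e - saddle_value c x (weight p e) e
     else if [forall a, (0 < p 0 a) ==> c a e] then x 0 e else 0).
Proof.
move=> Xp Xx.
have pA a : a \in sources (conflict c p x) -> 0 < p 0 a by case/sourcesP.
have xB b : b \in sinks (conflict c p x) -> 0 < x 0 b by case/sinksP.
have [t [tA tB te tV]] := optimal_times pA xB.
rewrite /Phi (logmap_vector csym Xp Xx tA tB te tV).
apply/rowP => e; rewrite !mxE /slope; case: ifPn => [eB|eB].
  have -> : p 0 e = 0 := sink_origin0 Xp eB.
  rewrite ltxx addr0; case: ifP => // /forallP h.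
  have /sinksP[_ [a pa]] := eB; have /implyP/(_ pa) -> // := h a.
have [eA|eA] := boolP (e \in sources (conflict c p x)).
  have pe := pA _ eA; rewrite pe (saddle_value_source Xp Xx tA tB te tV eA).
  by rewrite (source_target0 Xx eA); ring.
rewrite (negbTE eB) subrK; case: ifPn => pe.
  (* No positive entry of x conflicts with e here, so the singleton of e brings every minimum down
     to 0. *)
  rewrite (@saddle_valueP _ _ _ _ _ _ 0) ?subr0//.
    exists finset.set0; first by rewrite inE.
    by move=> S _ _; exact: sqrtr_ge0.
  move=> L eL; exists [set e]%SET; split; rewrite ?inE//.
    by rewrite disjoints1.
  rewrite /saddle_term big1 ?mulr0 ?sqrtr0// => b /setDP[/conflictingP[a]].
  rewrite inE => /eqP-> ceb _; apply/eqP; rewrite expf_eq0/=.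
  apply: contraNT eA => xb; apply/sourcesP; split=> //; exists b => //.
  by rewrite lt0r xb Xx.1.
case: ifPn => // /forallPn[a]; rewrite negb_imply => /andP[pa cae].
apply/eqP; apply: contraNT eB => xe; apply/sinksP; split.
  by rewrite lt0r xe Xx.1.
by exists a.
Qed.

Lemma clique_cone_segment (y z : 'rV[R]_M) (t : R) :
  clique_cone c y -> clique_cone c z ->
  (forall i, 0 < y 0 i -> 0 < z 0 i) -> 0 <= t <= 1 ->
  clique_cone c (y + t *: (z - y)).
Proof.
move=> Xy Xz yz /andP[t0 t1]; have t1' : 0 <= 1 - t by rewrite subr_ge0.
have E i : (y + t *: (z - y)) 0 i = (1 - t) * y 0 i + t * z 0 i.
  by rewrite !mxE; ring.
have pos i : 0 < (y + t *: (z - y)) 0 i -> 0 < z 0 i.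
  rewrite E => h; have [/yz//|y0] := ltP 0 (y 0 i).
  rewrite lt0r Xz.1 andbT; apply: contraTneq h => ->.
  by rewrite mulr0 addr0 -leNgt mulr_ge0_le0.
split=> [i|i j /pos zi /pos zj]; last exact: Xz.2.
by rewrite E addr_ge0// mulr_ge0// ?Xy.1 ?Xz.1.
Qed.

(** For small l, points within |w| l of xs have all the positive coordinates of xs, so the segments
    joining them to xs stay in X and their distance to xs is Euclidean. This makes any competing
    geodesic straight up to time l, and its initial tangent fixes its endpoint. *)
Lemma geodesic_point_near (xs w : 'rV[R]_M) : clique_cone c xs ->
  (\forall l \near 0^'+, clique_cone c (xs + l *: w)) ->
  \forall l \near 0^'+, geodesic_point (clique_cone c) xs l w = xs + l *: w.
Proof.
set X := clique_cone c => Xxs Xw.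
have small : \forall l \near (0 : R)^'+, forall i, 0 < xs 0 i -> enorm w * l < xs 0 i.
  apply: filter_forall => i; have [xi|xi] := ltP 0 (xs 0 i); last by apply: nearW.
  have := @cvg_perturb R 0 (enorm w); under eq_fun do rewrite add0r mulrC.
  by move=> /cvgr_lt/(_ _ xi); apply: filterS.
near=> l.
have l0 : 0 < l by near: l; exact: nbhs_right_gt.
have xl i : 0 < xs 0 i -> enorm w * l < xs 0 i by move: i; near: l.
have Xl : X (xs + l *: w) by near: l.
have close y : enorm (y - xs) <= enorm w * l ->
    forall i, 0 < xs 0 i -> 0 < y 0 i.
  move=> yx i /xl xi; have := le_trans (coord_le_enorm (y - xs) i) yx.
  by rewrite !mxE ler_norml => /andP[]; lra.
pose g (t : R) := xs + t *: w.
have gX t : 0 <= t <= l -> X (g t).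
  move=> /andP[t0 tl].
  have := @clique_cone_segment xs (xs + l *: w) (t / l) Xxs Xl.
  rewrite addrAC subrr add0r scalerA mulfVK ?gt_eqF//; apply; last first.
    by rewrite divr_ge0 ?(ltW l0)//= ler_pdivrMr// mul1r.
  by apply: close; rewrite addrAC subrr add0r enormZ gtr0_norm// mulrC.
have coneX := @clique_coneZ R M c.
apply: xget_unique.
  exists g; split=> //.
  - split=> // s t s0 t0; have Xs := gX _ s0; have Xt := gX _ t0.
    rewrite (intrinsic_dist_segment coneX Xs Xt) => [|u u01].
      by rewrite /g opprD addrACA subrr add0r -scalerBl enormZ distrC mulrC.
    have -> : g s + u *: (g t - g s) = g (s + u * (t - s)).
      rewrite /g opprD addrACA subrr add0r -scalerBl scalerA -addrA -scalerDl.
      by [].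
    by apply: gX; nra.
  - by rewrite /g scale0r addr0.
  - apply: cvg_near_cst; near=> t; have t0 : 0 < t by near: t; exact: nbhs_right_gt.
    by rewrite /g scale0r addr0 addrAC subrr add0r scalerA mulVf ?scale1r// gt_eqF.
move=> _ [h [[hX hd] h0 hw ->]].
have l01 : 0 <= l <= l by rewrite (ltW l0) lexx.
have z01 : (0 : R) <= 0 <= l by rewrite lexx (ltW l0).
have Xh := hX l l01.
have dl : intrinsic_dist X xs (h l) = enorm w * l.
  by rewrite -h0 hd// sub0r normrN gtr0_norm.
have zle : enorm (h l - xs) <= enorm w * l.
  by rewrite -dl; exact: enorm_le_intrinsic_dist.
have zE : enorm (h l - xs) = enorm w * l.
  rewrite -dl (intrinsic_dist_segment coneX)// => u u01.
  by apply: clique_cone_segment => //; exact: close.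
have hlin s : 0 < s <= l -> h s - xs = (s / l) *: (h l - xs).
  move=> /andP[s0 sl]; have s01 : 0 <= s <= l by rewrite ltW.
  have Xs := hX s s01.
  have us : enorm (h s - xs) <= enorm w * s.
    apply: le_trans (enorm_le_intrinsic_dist coneX Xxs Xs) _.
    by rewrite -h0 hd// sub0r normrN gtr0_norm.
  have zs : enorm (h l - h s) <= enorm w * (l - s).
    apply: le_trans (enorm_le_intrinsic_dist coneX Xs Xh) _.
    by rewrite hd// distrC ger0_norm// subr_ge0.
  set k := s / l; set u := h s - xs; set z := h l - xs.
  have k01 : 0 <= k <= 1 by rewrite /k divr_ge0 ?(ltW s0) ?(ltW l0)//= ler_pdivrMr// mul1r.
  have sk : s = k * l by rewrite mulfVK// gt_eqF.
  suff : enorm (u - k *: z) = 0 by move/enorm_eq0/eqP; rewrite subr_eq0 => /eqP.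
  apply/eqP; rewrite -sqrf_eq0 eq_le sqr_ge0 andbT sqr_enorm.
  (* Stewart's identity for the point k z on the side from 0 to z; inserting the bounds on the three
     lengths gives 0. *)
  have -> : \sum_i (u - k *: z) 0 i ^+ 2 = (1 - k) * enorm u ^+ 2 +
      k * enorm (h l - h s) ^+ 2 - k * (1 - k) * enorm z ^+ 2.
    rewrite !sqr_enorm !mulr_sumr -big_split -sumrB; apply: eq_bigr => i _ /=.
    by rewrite /u /z !mxE; ring.
  rewrite -/z in zE; rewrite zE.
  have us2 : enorm u ^+ 2 <= (enorm w * s) ^+ 2.
    by rewrite ler_sqr// nnegrE ?mulr_ge0 ?enorm_ge0// ltW.
  have zs2 : enorm (h l - h s) ^+ 2 <= (enorm w * (l - s)) ^+ 2.
    by rewrite ler_sqr// nnegrE ?mulr_ge0 ?enorm_ge0 ?subr_ge0.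
  apply: (@le_trans _ _ ((1 - k) * (enorm w * s) ^+ 2 +
      k * (enorm w * (l - s)) ^+ 2 - k * (1 - k) * (enorm w * l) ^+ 2)).
    by rewrite lerD2r lerD// ler_wpM2l//; case/andP: k01 => //; rewrite subr_ge0.
  by rewrite sk le_eqVlt; apply/orP; left; apply/eqP; ring.
have hw' : initial_tangent h (l^-1 *: (h l - xs)).
  apply: cvg_near_cst; near=> s.
  have s0 : 0 < s by near: s; exact: nbhs_right_gt.
  have sl : s <= l by near: s; exact: nbhs_right_le.
  have s0' : s != 0 by rewrite gt_eqF.
  by rewrite h0 hlin ?s0 ?sl// scalerA mulrA mulVf ?mul1r.
have <- : l^-1 *: (h l - xs) = w := cvg_unique (@norm_hausdorff _ _) hw' hw.
by rewrite scalerA mulfV ?scale1r ?gt_eqF// addrC subrK.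
Unshelve. all: by end_near. Qed.

End LogFormula.

(** * Orthant spaces *)

Section OrthantSpaces.
Context {R : realType} {M : nat}.
Implicit Types (E F G : {set 'I_M}) (X : set 'rV[R]_M).

Lemma orthant_sub_closure E G : orthant E `<=` closure (orthant G : set 'rV[R]_M) ->
  E \subset G.
Proof.
move=> EG; apply/fintype.subsetP => i iE.
pose v : 'rV[R]_M := \row_j (j \in E)%:R.
have vE : orthant E v.
  by move=> j; rewrite mxE; split=> [->|/negbTE ->].
have ci : (fun y : 'rV[R]_M => y 0 i) @ v --> v 0 i by exact: coord_continuous.
have /(cvgr_gt _) := ci => /(_ 0); rewrite mxE iE => /(_ ltr01) nv.
have [y [Gy yi]] := EG v vE _ nv.
by apply: contraT => /(Gy i).2 y0; rewrite y0 ltxx in yi.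
Qed.

Lemma subset_orthant_closure E G : E \subset G ->
  orthant E `<=` closure (orthant G : set 'rV[R]_M).
Proof.
move=> /fintype.subsetP EG v vE B Bv.
have cv : (\row_i (v 0 i + e * (i \in G :\: E)%:R) : 'rV[R]_M) @[e --> 0^'+] --> v.
  apply: cvg_rowP => i; under eq_fun do rewrite mxE; exact: cvg_perturb.
near (0 : R)^'+ => e; have e0 : 0 < e by near: e; exact: nbhs_right_gt.
exists (\row_i (v 0 i + e * (i \in G :\: E)%:R)); split; last first.
  by near: e; exact: cv.
move=> i; rewrite mxE !inE; have [vi vi0] := vE i; split=> [iG|iG].
  have [iE|iE] := boolP (i \in E); first by rewrite mulr0 addr0 vi.
  by rewrite iG vi0// add0r mulr1.
by rewrite (negbTE iG) andbF mulr0 addr0 vi0//; apply: contra iG => /EG.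
Unshelve. all: by end_near. Qed.

(** Adjacency means spanning a 2-dimensional stratum. Condition (a) puts all pairs from the support
    of a point of X in the graph; condition (b) puts the orthant of any clique in X. *)
Lemma orthant_spaceE m X : orthant_space m X ->
  exists2 c, symmetric c & X = clique_cone c.
Proof.
move=> [[S XS] _ Xa Xb].
(* The diagonal is added by hand: [clique_cone] also tests i = j, whereas (b) speaks of two-element
   sets. *)
pose c i j := (i == j) || `[< orthant [set i; j]%SET `<=` X >].
have csym : symmetric c by move=> i j; rewrite /c eq_sym finset.setUC.
exists c => //; apply/seteqP; split=> y.
  move=> Xy; have [E SE yE] : (\bigcup_(E in S) orthant E) y by rewrite -XS.
  have EX : orthant E `<=` X by rewrite XS; apply: bigcup_sup.
  have yP i : (0 < y 0 i) = (i \in E).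
    have [yi yi0] := yE i; have [iE|/yi0->] := boolP (i \in E); first by rewrite yi.
    by rewrite ltxx.
  split=> [i|i j]; first by have [yi yi0] := yE i; have [/yi/ltW|/yi0->] := boolP (i \in E).
  rewrite !yP => iE jE; rewrite /c; have [//|ij/=] := eqVneq i j.
  apply/asboolP; apply: (Xa _ E) => //; apply: subset_orthant_closure.
  by apply/fintype.subsetP => k; rewrite !inE => /orP[/eqP->|/eqP->].
move=> [y0 yc]; pose E := [set i | 0 < y 0 i]%SET.
apply: (Xb E) => [E2 /eqP/cards2P[i [j [ij ->]]] /orthant_sub_closure/fintype.subsetP h|].
  have := yc i j; have := h i; have := h j; rewrite !inE !eqxx orbT/=.
  move=> /(_ isT) yj /(_ isT) yi /(_ yi yj).
  by rewrite /c (negbTE ij)/= => /asboolP.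
by move=> i; rewrite inE; split=> // yi; apply/eqP; rewrite eq_le y0 andbT leNgt.
Qed.

End OrthantSpaces.
(** * Limits of the logarithm *)

Section SaddleLimit.
Context {R : realType} {M : nat} (c : rel 'I_M).
Implicit Types (p x : 'rV[R]_M) (E F : {set 'I_M}).

Lemma cvg_minr {T : Type} (F : set_system T) (f g : T -> R) (a b : R) : Filter F ->
  f t @[t --> F] --> a -> g t @[t --> F] --> b ->
  Num.min (f t) (g t) @[t --> F] --> Num.min a b.
Proof.
move=> FF fa gb; under eq_fun do rewrite minr_absE; rewrite minr_absE.
apply: cvgM; last exact: cvg_cst.
by apply: cvgB; [exact: cvgD|apply: cvg_norm; exact: cvgB].
Qed.

Lemma cvg_maxr {T : Type} (F : set_system T) (f g : T -> R) (a b : R) : Filter F ->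
  f t @[t --> F] --> a -> g t @[t --> F] --> b ->
  Num.max (f t) (g t) @[t --> F] --> Num.max a b.
Proof.
move=> FF fa gb; under eq_fun do rewrite maxr_absE; rewrite maxr_absE.
apply: cvgM; last exact: cvg_cst.
by apply: cvgD; [exact: cvgD|apply: cvg_norm; exact: cvgB].
Qed.

(* Unlike in [cvg_big], the default value varies. *)
Lemma cvg_bigop {T I : Type} (op : R -> R -> R) (F : set_system T) (r : seq I)
    (P : pred I) (d : T -> R) (d0 : R) (f : I -> T -> R) (l : I -> R) :
  (forall (f g : T -> R) a b, f t @[t --> F] --> a -> g t @[t --> F] --> b ->
    op (f t) (g t) @[t --> F] --> op a b) ->
  d t @[t --> F] --> d0 ->
  (forall i, P i -> f i t @[t --> F] --> l i) ->
  \big[op/d t]_(i <- r | P i) f i t @[t --> F] --> \big[op/d0]_(i <- r | P i) l i.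
Proof.
move=> opc dd fl; elim: r => [|i r IH].
  by rewrite big_nil; under eq_fun do rewrite big_nil.
rewrite big_cons; under eq_fun do rewrite big_cons.
by case: ifPn => // Pi; apply: opc => //; exact: fl.
Qed.

(** A finite max-min of continuous expressions. Only sets containing e occur, also in the default of
    the minimum, so convergence of their weights is enough. *)
Lemma cvg_saddle_value {T : Type} (F : set_system T) x e
    (w : T -> {set 'I_M} -> R) (w0 : {set 'I_M} -> R) : Filter F ->
  (forall S : {set 'I_M}, e \in S -> w t S @[t --> F] --> w0 S) ->
  saddle_value c x (w t) e @[t --> F] --> saddle_value c x w0 e.
Proof.
move=> FF ww.
have ct (L S : {set 'I_M}) : e \in S ->
    saddle_term c x (w t) L S @[t --> F] --> saddle_term c x w0 L S.
  move=> eS; apply: continuous_cvg; first exact: sqrt_continuous.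
  by apply: cvgM; [exact: ww|exact: cvg_cst].
apply: cvg_bigop => [f g a b||L eL]; [exact: cvg_maxr|exact: cvg_cst|].
apply: cvg_bigop => [f g a b||S /andP[eS _]]; [exact: cvg_minr| |exact: ct].
by apply: ct; rewrite inE.
Qed.

Lemma eq_saddle_value x e (w w' : {set 'I_M} -> R) :
  (forall S : {set 'I_M}, e \in S -> w S = w' S) ->
  saddle_value c x w e = saddle_value c x w' e.
Proof.
move=> ww; apply: eq_bigr => L _; rewrite /saddle_term ww ?inE//.
by apply: eq_bigr => S /andP[eS _]; rewrite ww.
Qed.

End SaddleLimit.

Section LogLimit.
Context {R : realType} {M : nat} (c : rel 'I_M) (csym : symmetric c).
Variables (E F : {set 'I_M}) (xs x : 'rV[R]_M).
Hypotheses (hxs : orthant E xs)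
  (Xxs : clique_cone c xs) (hEUF : orthant (E :|: F)%SET `<=` (clique_cone c : set 'rV[R]_M)) (hx : clique_cone c x).

Let xsE i : i \in E -> 0 < xs 0 i. Proof. by case: (hxs i). Qed.

Let xs0 i : i \notin E -> xs 0 i = 0. Proof. by case: (hxs i). Qed.

(* The first case is the quotient w_e^2 / |w_(S n F)|^2, left when all the entries
   of x* in S vanish. *)
Definition limit_weight (w : 'rV[R]_M) e (S : {set 'I_M}) :=
  if [disjoint S & E]%B then w 0 e ^+ 2 / \sum_(a in (S :&: F)%SET) w 0 a ^+ 2
  else weight xs e S.

Definition limit_log w : 'rV[R]_M := \row_e
  (if e \in (E :|: F)%SET then x 0 e - saddle_value c x (limit_weight w e) e
   else if [forall a in (E :|: F)%SET, c a e] then x 0 e else 0).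

Lemma orthant_near (w : 'rV[R]_M) : (forall i, i \in F -> 0 < w 0 i) ->
  (forall i, i \notin (E :|: F)%SET -> w 0 i = 0) ->
  \forall l \near 0^'+, orthant (E :|: F)%SET (xs + l *: w).
Proof.
move=> wF w0; apply: filter_forall => i; have [iEF|iEF] := boolP (i \in (E :|: F)%SET).
  have [iE|iE] := boolP (i \in E).
    have : \forall l \near 0^'+, 0 < xs 0 i + l * w 0 i.
      by apply: (cvgr_gt (xs 0 i)); [exact: cvg_perturb|exact: xsE].
    by apply: filterS => l l0; rewrite !mxE; split.
  have iF : i \in F by move: iEF; rewrite inE (negbTE iE).
  have : \forall l \near (0 : R)^'+, 0 < l by exact: nbhs_right_gt.
  apply: filterS => l l0; rewrite !mxE xs0// add0r.
  by split=> [_|]; [rewrite mulr_gt0// wF|].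
apply: nearW => l; rewrite !mxE w0// mulr0 addr0 xs0//.
by apply: contra iEF => iE; rewrite inE iE.
Qed.

(** If S meets E, the denominator has a positive limit. Otherwise the entries in S are l times those
    of w, and the factor l^2 cancels. *)
Lemma cvg_weight (w : 'rV[R]_M) e (S : {set 'I_M}) : (forall i, i \in F -> 0 < w 0 i) ->
  (forall i, i \notin (E :|: F)%SET -> w 0 i = 0) -> e \in (E :|: F)%SET -> e \in S ->
  weight (xs + l *: w) e S @[l --> 0^'+] --> limit_weight w e S.
Proof.
move=> wF w0 eEF eS; rewrite /limit_weight.
have cc a : (xs + l *: w) 0 a @[l --> 0^'+] --> xs 0 a.
  by under eq_fun do rewrite !mxE; exact: cvg_perturb.
case: ifPn => SE; last first.
  have [a aS aE] : exists2 a, a \in S & a \in E.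
    by have /pred0Pn[a /andP[]] := SE; exists a.
  have cs i : (xs + l *: w) 0 i ^+ 2 @[l --> 0^'+] --> xs 0 i ^+ 2 by exact: cvgM.
  apply: cvgM; first exact: cs.
  apply: cvgV; last by apply: cvg_sumr => i _; exact: cs.
  rewrite gt_eqF// (bigD1 a)//= ltr_pwDl ?exprn_gt0 ?xsE//.
  by rewrite sumr_ge0// => i _; rewrite sqr_ge0.
have Sxs a : a \in S -> xs 0 a = 0.
  by move=> aS; rewrite xs0// (disjointFr SE aS).
apply: cvg_near_cst; near=> l.
have l0 : l != 0 by rewrite gt_eqF//; near: l; exact: nbhs_right_gt.
rewrite /weight.
have -> : \sum_(a in S) (xs + l *: w) 0 a ^+ 2 =
    l ^+ 2 * \sum_(a in (S :&: F)%SET) w 0 a ^+ 2.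
  rewrite mulr_sumr [LHS]big_mkcond [RHS]big_mkcond/=; apply: eq_bigr => a _.
  rewrite inE !mxE; case: ifPn => // aS; rewrite Sxs// add0r exprMn.
  case: ifPn => // aF; rewrite w0 ?expr0n ?mulr0// inE negb_or aF andbT.
  by rewrite (disjointFr SE aS).
by rewrite !mxE Sxs// add0r exprMn -mulf_div divff ?mul1r// expf_neq0.
Unshelve. all: by end_near. Qed.

(** For small l the support is exactly the union of E and F, so each entry stays in one case of
    [PhiE]; those outside the union are eventually constant. *)
Lemma cvg_Phi (w : 'rV[R]_M) : (forall i, i \in F -> 0 < w 0 i) ->
  (forall i, i \notin (E :|: F)%SET -> w 0 i = 0) ->
  Phi (clique_cone c) x (xs + l *: w) @[l --> 0^'+] --> limit_log w.
Proof.
move=> wF w0; have near_o := orthant_near wF w0.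
apply: cvg_rowP => e; rewrite mxE; case: ifPn => eEF.
  have : x 0 e - saddle_value c x (weight (xs + l *: w) e) e @[l --> 0^'+] -->
      x 0 e - saddle_value c x (limit_weight w e) e.
    apply: cvgB; first exact: cvg_cst.
    by apply: cvg_saddle_value => S eS; exact: cvg_weight.
  apply: cvg_trans; apply: near_eq_cvg; move: near_o; apply: filterS => l ol.
  have Xl : clique_cone c (xs + l *: w) by exact: hEUF.
  by rewrite PhiE// [RHS]mxE (ol e).1.
apply: cvg_near_cst; move: near_o; apply: filterS => l ol.
have Xl : clique_cone c (xs + l *: w) by exact: hEUF.
rewrite PhiE// mxE (ol e).2// ltxx; congr (if _ then _ else _).
apply: eq_forallb => a; have [pos nul] := ol a.
by case: (boolP (a \in (E :|: F)%SET)) => [/pos ->|/nul ->]; rewrite ?ltxx.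
Qed.

(** A set containing e in E meets E, so all the weights involved are those at xs. *)
Lemma limit_log_restrict w e : e \in E ->
  limit_log w 0 e = Phi (clique_cone c) x xs 0 e.
Proof.
move=> eE; rewrite PhiE// !mxE inE eE xsE//=; congr (_ - _).
apply: eq_saddle_value => S eS; rewrite /limit_weight ifF//.
by apply/negP => /disjointFr/(_ eS); rewrite eE.
Qed.

End LogLimit.

Theorem corollary4 (R : realType) (M m : nat) (X : set 'rV[R]_M)
    (hX : orthant_space m X)
    (E F : {set 'I_M}) (hE : orthant E `<=` X)
    (hEF : [disjoint E & F]%B) (hF : F != finset.set0)
    (hEUF : orthant (E :|: F)%SET `<=` X)
    (xs x w : 'rV[R]_M) (hxs : orthant E xs) (hx : X x)
    (hw : tangent_vectors E F w) :
  (Phi_proj (E :|: F)%SET X x (geodesic_point X xs lam w) @[lam --> 0^'+]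
     --> Psi_proj (E :|: F)%SET X x w xs /\
   Phi_proj (E :|: F)%SET X x (geodesic_point X xs lam (orth_proj F w)) @[lam --> 0^'+]
     --> Psi_proj (E :|: F)%SET X x w xs) /\
  orth_proj E (Psi_proj (E :|: F)%SET X x w xs) = Phi_proj E X x xs.
Proof.
have [c csym XE] := orthant_spaceE hX; subst X.
have Xxs : clique_cone c xs by exact: hE.
have [v [u [vE uF wE]]] := hw.
have v0 i : i \notin E -> v 0 i = 0.
  by move=> iE; rewrite -vE mxE (negbTE iE).
have wF i : i \in F -> 0 < w 0 i.
  move=> iF; have iE : i \notin E by rewrite (disjointFl hEF iF).
  by rewrite wE mxE v0// add0r; exact: (uF i).1.
have w0 i : i \notin (E :|: F)%SET -> w 0 i = 0.
  rewrite inE negb_or => /andP[iE iF].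
  by rewrite wE mxE v0// add0r; exact: (uF i).2.
have pF i : i \in F -> 0 < orth_proj F w 0 i.
  by move=> iF; rewrite mxE iF wF.
have p0 i : i \notin (E :|: F)%SET -> orth_proj F w 0 i = 0.
  by rewrite inE negb_or mxE => /andP[_ /negbTE->].
(* Stated for a general direction, to serve both [w] and its component in F. *)
have cvg_geodesic (w' : 'rV[R]_M) : (forall i, i \in F -> 0 < w' 0 i) ->
    (forall i, i \notin (E :|: F)%SET -> w' 0 i = 0) ->
    Phi (clique_cone c) x (geodesic_point (clique_cone c) xs l w') @[l --> 0^'+]
      --> limit_log c E F xs x w'.
  move=> wF' w0'; have ho := orthant_near hxs wF' w0'.
  apply: cvg_trans (cvg_Phi csym hxs hEUF hx wF' w0').
  apply: near_eq_cvg; have : \forall l \near 0^'+,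
      geodesic_point (clique_cone c) xs l w' = xs + l *: w'.
    by apply: geodesic_point_near => //; move: ho; apply: filterS => l /hEUF.
  by apply: filterS => l ->.
(* Weights of sets meeting E do not involve w; for the other sets e is in F, and only entries of w
   in F occur. *)
have limw : limit_log c E F xs x (orth_proj F w) = limit_log c E F xs x w.
  apply/rowP => e; rewrite !mxE; case: ifPn => // eEF; congr (_ - _).
  apply: eq_saddle_value => S eS; rewrite /limit_weight; case: ifPn => // SE.
  have eF : e \in F by move: eEF; rewrite inE (disjointFr SE eS).
  congr (_ / _); first by rewrite mxE eF.
  by apply: eq_bigr => a; rewrite inE => /andP[_ aF]; rewrite mxE aF.
have PsiE : Psi (clique_cone c) x w xs = limit_log c E F xs x w.
  exact: (cvg_lim (@norm_hausdorff _ _) (cvg_geodesic _ wF w0)).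
have cvg_proj (G : {set 'I_M}) (w' l0 : 'rV[R]_M) :
    Phi (clique_cone c) x (geodesic_point (clique_cone c) xs l w') @[l --> 0^'+] --> l0 ->
    Phi_proj G (clique_cone c) x (geodesic_point (clique_cone c) xs l w') @[l --> 0^'+]
      --> orth_proj G l0.
  move=> cl; apply: cvg_rowP => i; rewrite mxE.
  under eq_fun do rewrite mxE.
  case: ifP => _; last exact: cvg_cst.
  apply: (cvg_comp _ (fun v : 'rV[R]_M => v 0 i) cl).
  exact: coord_continuous.
rewrite /Psi_proj PsiE; split; first split.
- exact/cvg_proj/cvg_geodesic.
- by rewrite -limw; exact/cvg_proj/cvg_geodesic.
apply/rowP => e; rewrite [LHS]mxE [RHS]mxE; case: ifPn => // eE.
by rewrite mxE inE eE/= (limit_log_restrict csym F hxs Xxs hx).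
Qed.
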